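(* The class of Dixmier-measurable operators in $\mathcal L_{1,\infty}$ is strictly contained in the class of $\mathcal D_M$-measurable operators in $\mathcal L_{1,\infty}$.
   Context: $\mu(n,A)$ denotes singular values, $\mu(t,A)=\mu(n,A)$ for $t\in[n,n+1)$; $\mathcal L_{1,\infty}=\{A\text{ compact}:\sup_n(n+1)\mu(n,A)<\infty\}$. An extended limit on $L_\infty(0,\infty)$ is a positive linear functional agreeing with $\lim_{t\to\infty}$ on convergent functions. A Dixmier trace is the linear extension of $\mathrm{Tr}_\omega(A)=\omega\big(t\mapsto\frac1{\log(1+t)}\int_0^t\mu(s,A)ds\big)$, $0\le A\in\mathcal L_{1,\infty}$, for an extended limit $\omega$ with $\omega(t\mapsto x(t/\beta))=\omega(x)$ for all $\beta>0$. With $(Mx)(t)=\frac1{\log t}\int_1^tx(s)\frac{ds}s$, $\mathcal D_M$ is the set of Dixmier traces $\mathrm{Tr}_\omega$ with $\omega=\omega\circ M$. An operator is Dixmier- (resp. $\mathcal D_M$-) measurable if all Dixmier traces (resp. all traces in $\mathcal D_M$) take the same value on it. *)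

(* Defs.v *)
From HB Require Import structures.
From mathcomp Require Import all_boot all_order all_algebra.
From mathcomp Require Import all_classical all_reals all_analysis.
From mathcomp Require Import complex.

Set Implicit Arguments.
Unset Strict Implicit.
Unset Printing Implicit Defensive.

Import Order.TTheory GRing.Theory Num.Theory.
Import numFieldNormedType.Exports.
Local Open Scope ring_scope.
Local Open Scope classical_set_scope.
Local Open Scope complex_scope.

Section DixmierDefs.
Variable R : realType.
Local Notation C := (R[i]).

Definition vec := nat -> C.

Definition sqmod (z : C) : R := (complex.Re z) ^+ 2 + (complex.Im z) ^+ 2.

Definition psum2 (x : vec) (N : nat) : R := \sum_(k < N) sqmod (x k).

Definition l2 (x : vec) : Prop := exists B : R, forall N, psum2 x N <= B.

Definition norm2 (x : vec) : R := Num.sqrt (sup (range (psum2 x))).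

(** * Bounded linear operators on H (only their action on l^2 matters) *)
Definition op := vec -> vec.

Definition is_bounded_op (T : op) : Prop :=
  [/\ (forall x, l2 x -> l2 (T x)),
      (forall (a : C) (x y : vec), l2 x -> l2 y ->
          T (fun k => a * x k + y k) = (fun k => a * T x k + T y k)) &
      exists c : R, forall x, l2 x -> norm2 (T x) <= c * norm2 x].

Definition opnorm (T : op) : R :=
  sup [set norm2 (T x) | x in [set x | l2 x /\ norm2 x <= 1]].

Definition op_eq (A B : op) : Prop := forall x, l2 x -> A x = B x.

Definition opsub (A B : op) : op := fun x k => A x k - B x k.

Definition rank_le (F : op) (n : nat) : Prop :=
  exists v : 'I_n -> vec, (forall i, l2 (v i)) /\
    forall x, l2 x -> exists c : 'I_n -> C,
      F x = (fun k => \sum_(i < n) c i * v i k).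

Definition sing_val (n : nat) (A : op) : R :=
  inf [set opnorm (opsub A F) | F in [set F | is_bounded_op F /\ rank_le F n]].

Definition sing_fun (A : op) (t : R) : R := sing_val `|Num.floor t|%N A.

(** * The weak trace ideal L_{1,oo} = { A compact : sup_n (n+1) mu(n,A) < oo }.
    (Compactness is implied by mu(n,A) -> 0 for the approximation numbers.) *)
Definition L1inf (A : op) : Prop :=
  is_bounded_op A /\ exists c : R, forall n, n.+1%:R * sing_val n A <= c.

Definition inner_psum (y x : vec) (N : nat) : C :=
  \sum_(k < N) y k * conjc (x k).

Definition is_pos_op (A : op) : Prop :=
  is_bounded_op A /\
  forall x, l2 x -> exists r : R, 0 <= r /\
    (fun N : nat => complex.Re (inner_psum (A x) x N)) @ \oo --> r /\
    (fun N : nat => complex.Im (inner_psum (A x) x N)) @ \oo --> (0 : R).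

Definition pos_half : set R := `]0, +oo[.

Definition Linf (x : R -> R) : Prop :=
  measurable_fun pos_half x /\
  exists c : R, {ae (@lebesgue_measure R), forall t, pos_half t -> `|x t| <= c}.

Definition ext_limit (om : (R -> R) -> R) : Prop :=
  [/\ (forall x y, Linf x -> Linf y -> om (fun t => x t + y t) = om x + om y),
      (forall (c : R) x, Linf x -> om (fun t => c * x t) = c * om x),
      (forall x, Linf x ->
          {ae (@lebesgue_measure R), forall t, pos_half t -> 0 <= x t} ->
          0 <= om x) &
      (forall x (l : R), Linf x -> x t @[t --> +oo] --> l -> om x = l)].

Definition dilation_invariant (om : (R -> R) -> R) : Prop :=
  forall x, Linf x -> forall beta : R, 0 < beta ->
    om (fun t => x (t / beta)) = om x.

Definition dixmier_omega (om : (R -> R) -> R) : Prop :=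
  ext_limit om /\ dilation_invariant om.

Definition Mop (x : R -> R) (t : R) : R :=
  (ln t)^-1 *
  (if 1 <= t then Rintegral (@lebesgue_measure R) `[1, t] (fun s => x s / s)
   else - Rintegral (@lebesgue_measure R) `[t, 1] (fun s => x s / s)).

Definition DM_omega (om : (R -> R) -> R) : Prop :=
  dixmier_omega om /\ forall x, Linf x -> om (Mop x) = om x.

Definition dixmier_fun (A : op) (t : R) : R :=
  (ln (1 + t))^-1 * Rintegral (@lebesgue_measure R) `[0, t] (sing_fun A).

Definition dixmier_trace_pos (om : (R -> R) -> R) (A : op) : R :=
  om (dixmier_fun A).

Definition pos_L1inf (B : op) : Prop := is_pos_op B /\ L1inf B.

(* v is the value of the linear extension of Tr_omega at A: writing
   A = B1 - B2 + i (B3 - B4) with 0 <= Bj in L_{1,oo}, linearity forces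
   Tr_omega(A) = Tr(B1) - Tr(B2) + i (Tr(B3) - Tr(B4)). *)
Definition ext_trace_value (om : (R -> R) -> R) (A : op) (v : C) : Prop :=
  exists B1 B2 B3 B4 : op,
    [/\ pos_L1inf B1 /\ pos_L1inf B2 /\ pos_L1inf B3 /\ pos_L1inf B4,
        op_eq A (fun x k => B1 x k - B2 x k + 'i * (B3 x k - B4 x k)) &
        v = (dixmier_trace_pos om B1 - dixmier_trace_pos om B2)%:C
            + 'i * (dixmier_trace_pos om B3 - dixmier_trace_pos om B4)%:C].

Definition measurable_for (P : ((R -> R) -> R) -> Prop) (A : op) : Prop :=
  forall om1 om2 v1 v2, P om1 -> P om2 ->
    ext_trace_value om1 A v1 -> ext_trace_value om2 A v2 -> v1 = v2.

Definition dixmier_measurable (A : op) : Prop := measurable_for dixmier_omega A.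
Definition DM_measurable (A : op) : Prop := measurable_for DM_omega A.

End DixmierDefs.

(* Main.v *)
Require Import Defs.
From HB Require Import structures.
From mathcomp Require Import all_boot all_order all_algebra.
From mathcomp Require Import all_classical all_reals all_analysis measurable_realfun.
From mathcomp Require Import complex ring lra.

(* The witness is the diagonal operator A with entries G(e+n+1) - G(e+n), where
   G(t) = ln t (4 + cos (ln ln t)); its partial sums telescope, so its Dixmier
   function is 4 + cos (ln ln t) up to O(1 / ln t).

   Modulo functions vanishing at infinity, M maps cos (ln ln t) and sin (ln ln t)
   to (cos + sin)/2 and (sin - cos)/2 of ln ln t.  Hence an M-invariant extended
   limit kills both functions, and every trace in D_M takes the value 4 on A.  On
   the other hand, logarithmic averages over windows on which ln ln t stays within
   1 of 2 pi n, respectively of (2 n + 1) pi, have ultrafilter limits that are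
   dilation invariant, since the logarithmic length of these windows tends to
   infinity; they send cos (ln ln t) above cos 1, respectively below - cos 1.

   Traces of A are defined through arbitrary decompositions into positive
   operators, so the additivity of Tr_omega is needed.  It follows from
   S_n(B1) + S_n(B2) <= S_2n(B3) + S_2n(B4) for positive operators with
   B1 + B2 = B3 + B4, where S_n is the sum of the n first singular values: the
   difference S_2n - S_n is bounded on L_{1,oo}.  This inequality is obtained from
   families of approximate eigenvectors, each of which nearly maximises the
   quadratic form on the orthogonal complement of the previous ones. *)

Set Implicit Arguments.
Unset Strict Implicit.
Unset Printing Implicit Defensive.

Import Order.TTheory GRing.Theory Num.Theory.
Import numFieldNormedType.Exports.
Local Open Scope ring_scope.
Local Open Scope classical_set_scope.
Local Open Scope complex_scope.

(** * Inner products and orthonormal families *)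

(** The oscillation sits in ln ln t because one in ln t is too fast: dividing t by [expR pi] changes
    the sign of cos (ln t), so every dilation invariant extended limit kills it. With u = ln t, the
    derivative of u g(ln u) in u is (g + g')(ln u), whence G'(t) = (4 + cos - sin)(ln ln t) / t. The
    constant 4 makes the numerator at least 2, which dominates its variation and keeps G'
    nonincreasing; the entries of the diagonal are then its singular values in order.

    On the operator side, singular values are given as distances to operators of finite rank, so no
    eigenbasis is at hand. A near maximiser of the form replaces each eigenvector, and every
    estimate carries an error linear in a tolerance e that is sent to 0 only in the final
    inequalities. *)

Section ComplexParts.
Variable R : realType.
Implicit Types a b c : R[i].

Lemma cReD a b : complex.Re (a + b) = complex.Re a + complex.Re b.
Proof. by case: a; case: b. Qed.

Lemma cImD a b : complex.Im (a + b) = complex.Im a + complex.Im b.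
Proof. by case: a; case: b. Qed.

Lemma cReN a : complex.Re (- a) = - complex.Re a.
Proof. by case: a. Qed.

Lemma cReM a b : complex.Re (a * b) =
  complex.Re a * complex.Re b - complex.Im a * complex.Im b.
Proof. by case: a; case: b. Qed.

Lemma cImM a b : complex.Im (a * b) =
  complex.Re a * complex.Im b + complex.Im a * complex.Re b.
Proof. by case: a; case: b. Qed.

Lemma cRe_sum I (r : seq I) (P : pred I) (F : I -> R[i]) :
  complex.Re (\sum_(i <- r | P i) F i) = \sum_(i <- r | P i) complex.Re (F i).
Proof. exact: (big_morph _ cReD). Qed.

Lemma cIm_sum I (r : seq I) (P : pred I) (F : I -> R[i]) :
  complex.Im (\sum_(i <- r | P i) F i) = \sum_(i <- r | P i) complex.Im (F i).
Proof. exact: (big_morph _ cImD). Qed.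

Lemma complex_eqP a b : complex.Re a = complex.Re b ->
  complex.Im a = complex.Im b -> a = b.
Proof. by case: a; case: b => ? ? ? ? /= -> ->. Qed.

Lemma cRe_conj a : complex.Re (conjc a) = complex.Re a.
Proof. by case: a. Qed.

Lemma cIm_conj a : complex.Im (conjc a) = - complex.Im a.
Proof. by case: a. Qed.

Lemma sqmod_ge0 a : 0 <= sqmod a.
Proof. by rewrite addr_ge0 // sqr_ge0. Qed.

Lemma sqmod_eq0 a : sqmod a = 0 -> a = 0.
Proof.
move/eqP; rewrite paddr_eq0 ?sqr_ge0 // !sqrf_eq0 => /andP[/eqP h /eqP k].
exact: complex_eqP.
Qed.

Lemma sqmod0 : sqmod (0 : R[i]) = 0.
Proof. by rewrite /sqmod /= expr0n addr0. Qed.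

Lemma sqmod_conj a : sqmod (conjc a) = sqmod a.
Proof. by rewrite /sqmod cRe_conj cIm_conj sqrrN. Qed.

Lemma sqmod_real (t : R) : sqmod t%:C = t ^+ 2.
Proof. by rewrite /sqmod /= expr0n addr0. Qed.

Lemma sqmodM a b : sqmod (a * b) = sqmod a * sqmod b.
Proof. rewrite /sqmod cReM cImM; ring. Qed.

Lemma mul_conj a : a * conjc a = (sqmod a)%:C.
Proof. by apply: complex_eqP; rewrite /sqmod ?cReM ?cImM cRe_conj cIm_conj /=; ring. Qed.

(* AM-GM, obtained by expanding [sqmod (t a +- conjc b) >= 0]. *)
Lemma abs_Re_mul_le a b (t : R) : 0 < t ->
  `|complex.Re (a * b)| <= (t * sqmod a + t^-1 * sqmod b) / 2.
Proof.
move=> t0; have tV : t * t^-1 = 1 by rewrite divff ?gt_eqF.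
have tV0 : 0 < t^-1 by rewrite invr_gt0.
have h s : s ^+ 2 = 1 :> R -> 0 <= t * sqmod a + t^-1 * sqmod b + s * 2 * complex.Re (a * b).
  move=> s1; have -> : t * sqmod a + t^-1 * sqmod b + s * 2 * complex.Re (a * b) =
    t^-1 * ((t * complex.Re a + s * complex.Re b) ^+ 2 +
            (t * complex.Im a - s * complex.Im b) ^+ 2).
    rewrite /sqmod cReM; set p := complex.Re a; set q := complex.Im a.
    set p' := complex.Re b; set q' := complex.Im b.
    transitivity ((t * t^-1) * t * (p ^+ 2 + q ^+ 2) + t^-1 * (s ^+ 2 * (p' ^+ 2 + q' ^+ 2)) +
       (t * t^-1) * s * 2 * (p * p' - q * q')); first by rewrite tV s1; ring.
    ring.
  by apply: mulr_ge0; [exact: ltW|rewrite addr_ge0 ?sqr_ge0].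
have := h 1; have := h (-1); rewrite sqrrN expr1n => /(_ erefl) h1 /(_ erefl) h2.
rewrite ler_norml; apply/andP; split; lra.
Qed.

End ComplexParts.

Section PreHilbert.
Variables (R : realType) (E : lmodType R[i]) (ip : E -> E -> R[i]).

Record inner_product : Prop := InnerProduct {
  ip_linear : forall a x y z, ip (a *: x + y) z = a * ip x z + ip y z;
  ip_conj : forall x y, ip y x = conjc (ip x y);
  ip_ge0 : forall x, 0 <= complex.Re (ip x x);
  ip_definite : forall x, complex.Re (ip x x) = 0 -> x = 0 }.

Hypothesis Hip : inner_product.
Implicit Types (x y z : E) (u w : nat -> E).

Definition sqnorm x : R := complex.Re (ip x x).

Lemma ipDl x y z : ip (x + y) z = ip x z + ip y z.
Proof. by have := ip_linear Hip 1 x y z; rewrite scale1r mul1r. Qed.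

Lemma ip0l z : ip 0 z = 0.
Proof. by apply: (addrI (ip 0 z)); rewrite -ipDl !addr0. Qed.

Lemma ipZl a x z : ip (a *: x) z = a * ip x z.
Proof. by have := ip_linear Hip a x 0 z; rewrite ip0l !addr0. Qed.

Lemma ipNl x z : ip (- x) z = - ip x z.
Proof. by rewrite -scaleN1r ipZl mulN1r. Qed.

Lemma ipBl x y z : ip (x - y) z = ip x z - ip y z.
Proof. by rewrite ipDl ipNl. Qed.

Lemma ipDr x y z : ip z (x + y) = ip z x + ip z y.
Proof. by rewrite (ip_conj Hip) ipDl rmorphD /= -!(ip_conj Hip). Qed.

Lemma ip0r z : ip z 0 = 0.
Proof. by rewrite (ip_conj Hip) ip0l rmorph0. Qed.

Lemma ipZr a x z : ip z (a *: x) = conjc a * ip z x.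
Proof. by rewrite (ip_conj Hip) ipZl rmorphM /= -(ip_conj Hip). Qed.

Lemma ipNr x z : ip z (- x) = - ip z x.
Proof. by rewrite (ip_conj Hip) ipNl rmorphN /= -(ip_conj Hip). Qed.

Lemma ipBr x y z : ip z (x - y) = ip z x - ip z y.
Proof. by rewrite ipDr ipNr. Qed.

Lemma ip_suml I (r : seq I) (P : pred I) (F : I -> E) z :
  ip (\sum_(i <- r | P i) F i) z = \sum_(i <- r | P i) ip (F i) z.
Proof. by apply: (big_morph (ip ^~ z)) => [x y|]; rewrite ?ipDl ?ip0l. Qed.

Lemma ip_sumr I (r : seq I) (P : pred I) (F : I -> E) z :
  ip z (\sum_(i <- r | P i) F i) = \sum_(i <- r | P i) ip z (F i).
Proof. by apply: (big_morph (ip z)) => [x y|]; rewrite ?ipDr ?ip0r. Qed.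

Lemma Re_ipC x y : complex.Re (ip x y) = complex.Re (ip y x).
Proof. by rewrite (ip_conj Hip) cRe_conj. Qed.

Lemma Im_ip_self x : complex.Im (ip x x) = 0.
Proof. by have := congr1 (@complex.Im R) (ip_conj Hip x x); rewrite cIm_conj; lra. Qed.

Lemma ip_self x : ip x x = (sqnorm x)%:C.
Proof. by apply: complex_eqP; rewrite //= Im_ip_self. Qed.

Lemma sqmod_ipC x y : sqmod (ip x y) = sqmod (ip y x).
Proof. by rewrite (ip_conj Hip) sqmod_conj. Qed.

Lemma sqnorm_ge0 x : 0 <= sqnorm x. Proof. exact: ip_ge0. Qed.

Lemma sqnorm_eq0 x : sqnorm x = 0 -> x = 0. Proof. exact: ip_definite. Qed.

Lemma sqnorm0 : sqnorm 0 = 0. Proof. by rewrite /sqnorm ip0l. Qed.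

Lemma sqnorm_gt0 x : x != 0 -> 0 < sqnorm x.
Proof.
by move=> x0; rewrite lt_neqAle sqnorm_ge0 andbT; apply: contra_neq x0 => /esym/sqnorm_eq0.
Qed.

Lemma sqnormD x y : sqnorm (x + y) = sqnorm x + 2 * complex.Re (ip x y) + sqnorm y.
Proof. by rewrite /sqnorm ipDl !ipDr !cReD (Re_ipC y x); lra. Qed.

Lemma sqnormZ a x : sqnorm (a *: x) = sqmod a * sqnorm x.
Proof. by rewrite /sqnorm ipZl ipZr mulrA mul_conj cReM /= mul0r subr0. Qed.

Lemma sqnormN x : sqnorm (- x) = sqnorm x.
Proof. by rewrite /sqnorm ipNl ipNr opprK. Qed.

Lemma cauchy_schwarz x y : sqmod (ip x y) <= sqnorm x * sqnorm y.
Proof.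
have [->|y0] := eqVneq y 0; first by rewrite ip0r sqnorm0 mulr0 sqmod0.
(* [sqnorm y] times the part of [x] orthogonal to [y]; this multiple avoids a division. *)
have := sqnorm_ge0 ((sqnorm y)%:C *: x - ip x y *: y).
rewrite sqnormD sqnormN !sqnormZ ipNr cReN ipZl ipZr [conjc _ * _]mulrC mul_conj.
have y1 := sqnorm_gt0 y0; rewrite cReM /=.
set n := sqnorm y in y1 *; set m := sqnorm x; set s := sqmod (ip x y).
rewrite [sqmod n%:C]/sqmod /= expr0n addr0.
move=> h; have nm : 0 <= n * (m * n - s) by lra.
by rewrite -subr_ge0 -(pmulr_rge0 _ y1).
Qed.

Definition orthonormal_fam n u := forall i j, (i < n)%N -> (j < n)%N ->
  ip (u i) (u j) = (i == j)%:R.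

Definition oproj n u x := \sum_(i < n) ip x (u i) *: u i.

Lemma ip_combination n u (a : nat -> R[i]) j : orthonormal_fam n u -> (j < n)%N ->
  ip (\sum_(i < n) a i *: u i) (u j) = a j.
Proof.
move=> on jn; rewrite ip_suml (bigD1 (Ordinal jn)) //= ipZl on // eqxx mulr1.
rewrite big1 ?addr0 // => i ij; rewrite ipZl on //.
by rewrite (_ : (_ == _) = false) ?mulr0 //; apply: contra_neqF ij => /eqP h; apply: val_inj.
Qed.

Lemma ip_proj n u x j : orthonormal_fam n u -> (j < n)%N -> ip (oproj n u x) (u j) = ip x (u j).
Proof. exact: (@ip_combination n u (fun i => ip x (u i))). Qed.

Lemma ip_sub_proj n u x j : orthonormal_fam n u -> (j < n)%N -> ip (x - oproj n u x) (u j) = 0.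
Proof. by move=> on jn; rewrite ipBl ip_proj // subrr. Qed.

Lemma sqnorm_combination n u (a : nat -> R[i]) : orthonormal_fam n u ->
  sqnorm (\sum_(i < n) a i *: u i) = \sum_(i < n) sqmod (a i).
Proof.
move=> on; rewrite /sqnorm ip_sumr cRe_sum; apply: eq_bigr => i _.
by rewrite ipZr ip_combination // mulrC mul_conj.
Qed.

Lemma sqnorm_sub_proj n u x : orthonormal_fam n u ->
  sqnorm (x - oproj n u x) = sqnorm x - \sum_(i < n) sqmod (ip x (u i)).
Proof.
move=> on; rewrite sqnormD sqnormN (sqnorm_combination (fun i => ip x (u i))) // ipNr cReN.
rewrite {1}/oproj ip_sumr cRe_sum (_ : \sum_i complex.Re _ = \sum_(i < n) sqmod (ip x (u i))).
  by lra.
by apply: eq_bigr => i _; rewrite ipZr mulrC mul_conj.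
Qed.

Lemma bessel n u x : orthonormal_fam n u -> \sum_(i < n) sqmod (ip x (u i)) <= sqnorm x.
Proof. by move=> on; rewrite -subr_ge0 -sqnorm_sub_proj // sqnorm_ge0. Qed.

Lemma orthonormal_sqnorm n u i : orthonormal_fam n u -> (i < n)%N -> sqnorm (u i) = 1.
Proof. by move=> on i0; rewrite /sqnorm on // eqxx. Qed.

Lemma orthonormal_le m n u : (m <= n)%N -> orthonormal_fam n u -> orthonormal_fam m u.
Proof. by move=> mn on i j im jm; apply: on; apply: leq_trans mn. Qed.

Lemma orthonormal_rcons n u x : orthonormal_fam n u -> sqnorm x = 1 ->
  (forall i, (i < n)%N -> ip x (u i) = 0) ->
  orthonormal_fam n.+1 (fun i => if (i < n)%N then u i else x).
Proof.
move=> on x1 xu i j; rewrite !ltnS => iN jN.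
have [i0|i0] := ltnP i n; have [j0|j0] := ltnP j n.
- exact: on.
- by rewrite (ip_conj Hip) xu // rmorph0 (ltn_eqF (leq_trans i0 j0)).
- by rewrite xu // (gtn_eqF (leq_trans j0 i0)).
- have -> : i = n by apply/eqP; rewrite eqn_leq iN.
  have -> : j = n by apply/eqP; rewrite eqn_leq jN.
  by rewrite ip_self x1 eqxx.
Qed.

Lemma ip_sub_proj_self n u x : orthonormal_fam n u ->
  ip x (x - oproj n u x) = (sqnorm (x - oproj n u x))%:C.
Proof.
move=> on; set r := x - _; rewrite -[x in LHS](subrK (oproj n u x)) -/r ipDl -ip_self /oproj ip_suml.
rewrite big1 ?addr0 // => i _.
by rewrite ipZl (ip_conj Hip r) ip_sub_proj // rmorph0 mulr0.
Qed.

(** Equality in Bessel's inequality. [singnum_le_trace] consumes membership in the span in this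
    form: the weights of [x] along the [w j] add up to [sqnorm x]. *)
Definition in_span_of m w x := \sum_(j < m) sqmod (ip x (w j)) = sqnorm x.

Lemma gram_schmidt (s : seq E) : exists m w, [/\ (m <= size s)%N, orthonormal_fam m w &
  forall x, x \in s -> in_span_of m w x].
Proof.
elim: s => [|x s [m [w [ms on hs]]]]; first by exists 0, (fun=> 0); split.
set r := x - oproj m w x.
have r0 := sqnorm_sub_proj x on.
have [rE|rN] := eqVneq r 0.
  exists m, w; split=> [||y]; [exact: leqW|by []|].
  rewrite inE => /predU1P[->|/hs //].
  by apply/esym/eqP; rewrite -subr_eq0 -r0 -/r rE sqnorm0.
have rp := sqnorm_gt0 rN; set q := (Num.sqrt (sqnorm r))^-1.
have q2 : q ^+ 2 * sqnorm r = 1.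
  by rewrite /q exprVn sqr_sqrtr ?sqnorm_ge0 // mulVf ?gt_eqF.
have qC := sqmod_real q.
have on' : orthonormal_fam m.+1 (fun i => if (i < m)%N then w i else q%:C *: r).
  apply: orthonormal_rcons; rewrite ?sqnormZ ?qC // => i im.
  by rewrite ipZl ip_sub_proj // mulr0.
exists m.+1, (fun i => if (i < m)%N then w i else q%:C *: r); split=> // y.
have sumE y' : \sum_(j < m.+1) sqmod (ip y' (if (j < m)%N then w j else q%:C *: r)) =
    \sum_(j < m) sqmod (ip y' (w j)) + q ^+ 2 * sqmod (ip y' r).
  rewrite big_ord_recr /= ltnn ipZr sqmodM sqmod_conj qC; congr (_ + _).
  by apply: eq_bigr => i _; rewrite ltn_ord.
rewrite inE => /predU1P[->|ys].
  rewrite /in_span_of sumE.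
  rewrite /r ip_sub_proj_self // -/r sqmod_real.
  by rewrite [sqnorm r ^+ 2]expr2 mulrA q2 mul1r /r r0; lra.
(* For an earlier vector the new term can only increase the sum, which Bessel bounds by
   [sqnorm y]. *)
apply/eqP; rewrite eq_le (bessel y on') /= sumE (hs y ys) lerDl.
by rewrite mulr_ge0 ?sqr_ge0 ?sqmod_ge0.
Qed.

End PreHilbert.

(** * Approximate eigenvectors of positive operators *)

Section PositiveOperators.
Variables (R : realType) (E : lmodType R[i]) (ip : E -> E -> R[i]).
Hypothesis Hip : inner_product ip.
Implicit Types (x y z : E) (u w : nat -> E) (B F : E -> E).

Local Notation sqnorm := (sqnorm ip).
Local Notation orthonormal_fam := (orthonormal_fam ip).
Local Notation oproj := (oproj ip).

Definition linear_op B := forall a x y, B (a *: x + y) = a *: B x + B y.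

Definition qform B x : R := complex.Re (ip (B x) x).

(** Self-adjointness follows from [pos_Im] by polarization. The bound on the form keeps the supremum
    in [greedy] finite. *)
Record positive_op B : Prop := PositiveOp {
  pos_linear : linear_op B;
  pos_Im : forall x, complex.Im (ip (B x) x) = 0;
  pos_ge0 : forall x, 0 <= qform B x;
  pos_bounded : exists c, forall x, qform B x <= c * sqnorm x }.

Section LinearOp.
Variable B : E -> E.
Hypothesis linB : linear_op B.

Lemma linear_op0 : B 0 = 0.
Proof.
have := linB 1 0 0; rewrite !scale1r addr0 => h.
by apply: (addrI (B 0)); rewrite -h addr0.
Qed.

Lemma linear_opD x y : B (x + y) = B x + B y.
Proof. by have := linB 1 x y; rewrite !scale1r. Qed.

Lemma linear_opZ a x : B (a *: x) = a *: B x.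
Proof. by have := linB a x 0; rewrite linear_op0 !addr0. Qed.

Lemma linear_op_sum I (r : seq I) (P : pred I) (G : I -> E) :
  B (\sum_(i <- r | P i) G i) = \sum_(i <- r | P i) B (G i).
Proof. exact: (big_morph B linear_opD linear_op0). Qed.

End LinearOp.

Section Form.
Variable B : E -> E.
Hypothesis linB : linear_op B.
Hypothesis imB : forall x, complex.Im (ip (B x) x) = 0.

(* Polarization in [x + y] and ['i x + y]. *)
Lemma real_form_selfadjoint x y : ip (B x) y = ip x (B y).
Proof.
have h1 := imB (x + y); have h2 := imB ('i *: x + y).
rewrite (linear_opD linB) !(ipDl Hip, ipDr Hip) !cImD !imB in h1.
rewrite (linear_opD linB) (linear_opZ linB) in h2.
rewrite !(ipDl Hip, ipDr Hip, ipZl Hip, ipZr Hip, cImD, cReD, cImM, cReM, imB) /= in h2.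
rewrite (ip_conj Hip (B y)); apply: complex_eqP; rewrite ?cRe_conj ?cIm_conj; lra.
Qed.

Lemma qformD x y : qform B (x + y) = qform B x + 2 * complex.Re (ip (B x) y) + qform B y.
Proof.
rewrite /qform (linear_opD linB) !(ipDl Hip, ipDr Hip) !cReD.
rewrite (Re_ipC Hip (B y) x) -real_form_selfadjoint; lra.
Qed.

Lemma qformZ a x : qform B (a *: x) = sqmod a * qform B x.
Proof.
by rewrite /qform (linear_opZ linB) ipZl // ipZr // mulrA mul_conj cReM /= mul0r subr0.
Qed.

Lemma qform0 : qform B 0 = 0.
Proof. by rewrite /qform ip0r. Qed.

(** 4 Re <Bx, y> is the difference of the forms at x + y and x - y, hence at most 2 c (|x|^2 +
    |y|^2); then y is taken to be Bx / c. *)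
Lemma sqnorm_le_of_form (c : R) : 0 < c -> (forall x, `|qform B x| <= c * sqnorm x) ->
  forall x, sqnorm (B x) <= c ^+ 2 * sqnorm x.
Proof.
move=> c0 hB x.
have h y : 2 * complex.Re (ip (B x) y) <= c * (sqnorm x + sqnorm y).
  have h1 := ler_normlW (hB (x + y)); have h2 := hB (x + - y).
  rewrite ler_norml in h2; case/andP: h2 => h2 _.
  rewrite !qformD -scaleN1r qformZ !sqnormD // in h1 h2.
  rewrite !ipZr // sqnormZ // cReM cReM /= in h2.
  have s1 : sqmod (- 1 : R[i]) = 1 by rewrite /sqmod /= oppr0 expr0n addr0 sqrrN expr1n.
  rewrite s1 oppr0 in h2.
  lra.
have := h (c^-1%:C *: B x); rewrite ipZr // sqnormZ // sqmod_real cReM /= oppr0 mul0r subr0.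
rewrite -/(sqnorm (B x)); set n := sqnorm (B x); set m := sqnorm x.
rewrite mulrDr exprVn => hh.
have e : c * (c ^- 2 * n) = c^-1 * n by field; rewrite gt_eqF.
rewrite e in hh.
have : c^-1 * n <= c * m by lra.
by rewrite mulrC ler_pdivrMr // => hn; rewrite expr2 mulrAC.
Qed.

End Form.

Section Greedy.
Variable B : E -> E.
Hypothesis posB : positive_op B.
Hypothesis infdim : forall n u, exists x, sqnorm x = 1 /\
  forall i, (i < n)%N -> ip x (u i) = 0.
Let linB := pos_linear posB.
Let imB := pos_Im posB.
Let sa := real_form_selfadjoint linB imB.

(** At a unit vector [qform B x] is the Rayleigh quotient, so the defect vanishes exactly at
    eigenvectors. *)
Definition defect x := B x - (qform B x)%:C *: x.

Lemma ip_form x : ip (B x) x = (qform B x)%:C.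
Proof. by apply: complex_eqP => //=; exact: imB. Qed.

Lemma ip_defect x : sqnorm x = 1 -> ip (defect x) x = 0.
Proof.
by move=> x1; rewrite ipBl // ipZl // ip_self // x1 mulr1 ip_form subrr.
Qed.

Definition approx_eigenbasis n (e : R) u := [/\ orthonormal_fam n u,
  forall i, (i < n)%N -> sqnorm (defect (u i)) <= e ^+ 2 &
  forall k z, (k < n)%N -> (forall i, (i < k)%N -> ip z (u i) = 0) ->
    qform B z <= (qform B (u k) + e) * sqnorm z].

(* A near maximiser of the form on the orthogonal complement of the previous
   vectors is nearly an eigenvector, by the first variation of the form. *)
Lemma near_maximiser_residual n u z (s c eta : R) : orthonormal_fam n u -> sqnorm z = 1 ->
  (forall i, (i < n)%N -> ip z (u i) = 0) ->
  (forall y, (forall i, (i < n)%N -> ip y (u i) = 0) -> qform B y <= s * sqnorm y) ->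
  s - eta <= qform B z -> s <= c ->
  sqnorm (defect z - oproj n u (defect z)) <= eta * (c + 1).
Proof.
move=> on z1 zu hs hz sc; set r := defect z; set r' := r - _.
have r'u i : (i < n)%N -> ip r' (u i) = 0 by move=> ?; rewrite ip_sub_proj.
have zr' : ip z r' = 0.
  rewrite ipBr // (ip_conj Hip r) ip_defect // rmorph0 /oproj ip_sumr // big1 ?subr0 // => i _.
  by rewrite ipZr // zu // mulr0.
have Bzr' : ip (B z) r' = (sqnorm r')%:C.
  rewrite -[B z](subrK ((qform B z)%:C *: z)) -/(defect z) -/r ipDl // ipZl // zr' mulr0 addr0.
  by rewrite ip_sub_proj_self.
have s0 : 0 <= s by rewrite (le_trans (pos_ge0 posB z)) // (le_trans (hs z zu)) // z1 mulr1.
(* The test vector is [z + t r']. With this [t] the quadratic loss [s t^2 rho] is at most half of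
   the linear gain [2 t rho]; adding 1 covers [s = 0]. *)
set t := (s + 1)^-1; have s1 : 0 < s + 1 by lra.
have tE : t * (s + 1) = 1 by rewrite mulVf ?gt_eqF.
have t0 : 0 < t by rewrite invr_gt0.
have yu i : (i < n)%N -> ip (z + t%:C *: r') (u i) = 0.
  by move=> ?; rewrite ipDl // ipZl // zu // r'u // mulr0 addr0.
have := hs _ yu; rewrite qformD // qformZ // sqnormD // sqnormZ // !ipZr //.
rewrite zr' Bzr' sqmod_real z1 !cReM /= oppr0; set rho := sqnorm r' => h.
have rho0 : 0 <= rho by exact: sqnorm_ge0.
have h1 : 0 <= t ^+ 2 * qform B r' by rewrite mulr_ge0 ?sqr_ge0 // (pos_ge0 posB).
have h2 : 2 * (t * rho) <= eta + s * t * (t * rho) by rewrite expr2 in h1 h; lra.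
have h3 : s * t * (t * rho) <= t * rho.
  by rewrite ler_piMl ?mulr_ge0 ?(ltW t0) //; lra.
have h4 : t * rho <= eta by lra.
have e0 : 0 <= eta by rewrite (le_trans _ h4) // mulr_ge0 // ltW.
have h5 : rho <= eta * (s + 1).
  have rE : rho = t * rho * (s + 1) by rewrite mulrAC tE mul1r.
  by rewrite rE ler_wpM2r // ltW.
by rewrite (le_trans h5) // ler_wpM2l //; lra.
Qed.

Lemma form_le_scale n u (s : R) :
  (forall y, sqnorm y = 1 -> (forall i, (i < n)%N -> ip y (u i) = 0) -> qform B y <= s) ->
  forall y, (forall i, (i < n)%N -> ip y (u i) = 0) -> qform B y <= s * sqnorm y.
Proof.
move=> hs y yu; have [->|y0] := eqVneq y 0; first by rewrite qform0 sqnorm0 // mulr0.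
have y1 := sqnorm_gt0 Hip y0; set q := (Num.sqrt (sqnorm y))^-1.
have q2 : q ^+ 2 = (sqnorm y)^-1 by rewrite /q exprVn sqr_sqrtr // ltW.
have := hs (q%:C *: y); rewrite sqnormZ // qformZ // sqmod_real q2 mulVf ?gt_eqF //.
rewrite mulrC ler_pdivrMr //; apply=> // i im.
by rewrite ipZl // yu // mulr0.
Qed.

Lemma greedy n (e : R) : 0 < e -> exists u, approx_eigenbasis n e u.
Proof.
elim: n e => [|n IH] e e0; first by exists (fun=> 0); split.
have [c hc] := pos_bounded posB.
(* With this tolerance the coefficients of the new defect along the [n] previous vectors contribute
   at most [e^2 / 4]. *)
pose e' : R := e / (2 * n.+1%:R).
have N0 : (1 : R) <= n.+1%:R by rewrite ler1n.
have e'0 : 0 < e' by rewrite divr_gt0 // mulr_gt0 //; lra.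
have e'E : e' * (2 * n.+1%:R) = e by rewrite mulfVK // gt_eqF //; lra.
have [u [on ud um]] := IH _ e'0.
pose S := [set qform B z | z in [set z | sqnorm z = 1 /\ forall i, (i < n)%N -> ip z (u i) = 0]].
have [z0 hz0] := infdim n u.
have hS : has_sup S.
  split; first by exists (qform B z0), z0.
  by exists c => _ [z [z1 _] <-]; rewrite (le_trans (hc z)) // z1 mulr1.
have c0 : 0 <= c.
  by rewrite (le_trans (pos_ge0 posB z0)) // (le_trans (hc z0)) // (hz0.1) mulr1.
(* The bound by [e] gives near maximality; the other one bounds by [e^2 / 2] the square norm of the
   part of the defect orthogonal to the previous vectors. *)
pose eta := Num.min e (e ^+ 2 / (2 * (c + 1))).
have c1 : 0 < 2 * (c + 1) by lra.
have eta0 : 0 < eta by rewrite lt_min e0 /= divr_gt0 // exprn_gt0.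
have [_ [z [z1 zu] <-] hz] := sup_adherent eta0 hS.
have hs : forall y, (forall i, (i < n)%N -> ip y (u i) = 0) -> qform B y <= sup S * sqnorm y.
  by apply: form_le_scale => y y1 yu; apply: ub_le_sup; [exact: hS.2|exists y].
have sc : sup S <= c.
  by apply: ge_sup; [exact: hS.1|move=> _ [y [y1 _] <-]; rewrite (le_trans (hc y)) // y1 mulr1].
have := near_maximiser_residual on z1 zu hs (ltW hz) sc; set r := defect z => hr.
have rE := sqnorm_sub_proj Hip r on.
have rs : \sum_(i < n) sqmod (ip r (u i)) <= n%:R * e' ^+ 2.
  rewrite -[n in n%:R]card_ord -sumr_const mulr_suml ler_sum // => i _; rewrite mul1r.
  (* Self-adjointness and the orthogonality of [z] and [u i] move the defect from [z] to [u i],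
     where the induction hypothesis bounds it. *)
  have -> : ip r (u i) = ip z (defect (u i)).
    by rewrite ipBl // ipBr // ipZl // ipZr // zu // !mulr0 !subr0 sa.
  by rewrite (le_trans (cauchy_schwarz Hip _ _)) // z1 mul1r ud.
have hn : n%:R * e' ^+ 2 <= e ^+ 2 / 4.
  have -> : e ^+ 2 / 4 = n.+1%:R * n.+1%:R * e' ^+ 2 by rewrite -[in LHS]e'E; field.
  have : n%:R * e' ^+ 2 <= n.+1%:R * e' ^+ 2.
    by rewrite ler_wpM2r ?sqr_ge0 // ler_nat.
  have : n.+1%:R * e' ^+ 2 <= n.+1%:R * n.+1%:R * e' ^+ 2.
    by rewrite ler_wpM2r ?sqr_ge0 // ler_peMl ?ler0n.
  by move=> h1 h2; exact: le_trans h2 h1.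
have he : eta * (c + 1) <= e ^+ 2 / 2.
  rewrite (_ : e ^+ 2 / 2 = e ^+ 2 / (2 * (c + 1)) * (c + 1)).
    by rewrite ler_wpM2r ?ge_min ?lexx ?orbT //; lra.
  by rewrite invfM !mulrA mulfVK // gt_eqF //; lra.
have e'e : e' <= e.
  by rewrite -[leRHS]e'E ler_peMr ?(ltW e'0) //; lra.
exists (fun i => if (i < n)%N then u i else z); split.
- exact: orthonormal_rcons.
- move=> i; rewrite ltnS => iN; case: ifP => i0.
    by rewrite (le_trans (ud i i0)) // lerXn2r // nnegrE ltW.
  have : 0 <= e ^+ 2 by rewrite sqr_ge0.
  rewrite -/r; lra.
move=> k y; rewrite ltnS => kN yu; case: ifP => k0.
  rewrite (le_trans (um k y k0 _)) ?ler_wpM2r ?sqnorm_ge0 ?lerD2l // => i ik.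
  by have := yu i ik; rewrite (ltn_trans ik k0).
have kE : k = n by apply/eqP; rewrite eqn_leq kN leqNgt k0.
rewrite (le_trans (hs y _)) => [//|i im|].
  by have := yu i; rewrite kE im => ->.
rewrite ler_wpM2r ?sqnorm_ge0 //; have : eta <= e by rewrite ge_min lexx.
by move: hz; lra.
Qed.

End Greedy.
End PositiveOperators.

(** * Ky Fan inequalities *)

Lemma le_of_le_addM (R : realFieldType) (a b C : R) : 0 <= C ->
  (forall e, 0 < e -> a <= b + C * e) -> a <= b.
Proof.
move=> C0 h; apply/ler_addgt0Pr => e e0.
have C1 : 0 < C + 1 by lra.
rewrite (le_trans (h (e / (C + 1)) _)) ?divr_gt0 // lerD2l mulrA ler_pdivrMr //.
by rewrite mulrC ler_pM2l //; lra.
Qed.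

Lemma sum_const_ord (R : pzRingType) n (c : R) : \sum_(i < n) c = n%:R * c.
Proof. by rewrite sumr_const card_ord mulr_natl. Qed.

Section SingularNumbers.
Variables (R : realType) (E : lmodType R[i]) (ip : E -> E -> R[i]).
Hypothesis Hip : inner_product ip.
Hypothesis infdim : forall n (u : nat -> E), exists x, sqnorm ip x = 1 /\
  forall i, (i < n)%N -> ip x (u i) = 0.
Implicit Types (x y z : E) (u w : nat -> E) (B F : E -> E).

Local Notation sqnorm := (sqnorm ip).
Local Notation orthonormal_fam := (orthonormal_fam ip).
Local Notation oproj := (oproj ip).
Local Notation qform := (qform ip).

Definition finite_rank F k := exists v : 'I_k -> E,
  forall x, exists c : 'I_k -> R[i], F x = \sum_(i < k) c i *: v i.

(** The approximation numbers, characterised by their two defining inequalities: [mu k] is the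
    distance from [B] to the operators of rank at most [k]. This separates the inequalities below
    from the [sup] and [inf] inside [sing_val]. *)
Record singular_numbers B (mu : nat -> R) : Prop := SingularNumbers {
  singnum_ge0 : forall k, 0 <= mu k;
  singnum_le : forall k F (c : R), linear_op F -> finite_rank F k -> 0 <= c ->
    (forall x, sqnorm (B x - F x) <= c ^+ 2 * sqnorm x) -> mu k <= c;
  singnum_approx : forall k (e : R), 0 < e -> exists F, [/\ linear_op F, finite_rank F k &
    forall x, sqnorm (B x - F x) <= (mu k + e) ^+ 2 * sqnorm x] }.

(** The coordinates of the [F (u i)] along [v] form a matrix with more rows than columns, so its
    left kernel is nonzero. That the combination itself is nonzero comes from orthonormality where
    the lemma is used. *)
Lemma finite_rank_kernel F k u : linear_op F -> finite_rank F k ->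
  exists a : nat -> R[i], (exists2 i, (i < k.+1)%N & a i != 0) /\
    F (\sum_(i < k.+1) a i *: u i) = 0.
Proof.
move=> linF [v hv]; have [c hc] := choice (fun i : 'I_k.+1 => hv (u i)).
pose M : 'M[R[i]]_(k.+1, k) := \matrix_(i, j) c i j.
have kM : kermx M != 0.
  by rewrite -mxrank_eq0 mxrank_ker subn_eq0 -ltnNge ltnS rank_leq_col.
have /rowV0Pn[r /sub_kermxP rM r0] := kM.
exists (fun i => r 0 (inord i)); split.
  have [j hj] : exists j, r 0 j != 0 by apply/existsP; apply: contraNT r0;
    rewrite negb_exists => /forallP h; apply/eqP/rowP => j; rewrite mxE; apply/eqP/negPn.
  by exists j => //; rewrite inord_val.
rewrite linear_op_sum //; under eq_bigr => i _ do
  rewrite linear_opZ // hc inord_val scaler_sumr.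
rewrite exchange_big /= big1 // => j _.
under eq_bigr => i _ do rewrite scalerA.
rewrite -scaler_suml; have /rowP/(_ j) := rM; rewrite !mxE => rj.
under eq_bigr => i _ do rewrite -[c i j](mxE matrix_key (fun i j => c i j)).
by rewrite rj scale0r.
Qed.

Section OneOperator.
Variables (B : E -> E) (mu : nat -> R).
Hypothesis posB : positive_op ip B.
Hypothesis snB : singular_numbers B mu.
Let linB := pos_linear posB.
Let imB := pos_Im posB.

(** For exact eigenvectors the two sides agree. Each defect adds one error term, its pairing with x
    + z = y + 2 z, because the cross term Re <By, z> of the form counts twice. *)
Lemma form_approx_diagonal m (e : R) u x : 0 < e -> orthonormal_fam m u ->
  (forall i, (i < m)%N -> sqnorm (defect ip B (u i)) <= e ^+ 2) ->
  `|qform B x - (\sum_(i < m) qform B (u i) * sqmod (ip x (u i)) +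
                qform B (x - oproj m u x))| <= m%:R * (2 * e) * sqnorm x.
Proof.
move=> e0 on ud; set y := oproj m u x; set z := x - y.
have zu i : (i < m)%N -> ip z (u i) = 0 by move=> ?; rewrite ip_sub_proj.
have By v : ip (B y) v = \sum_(i < m) ip x (u i) * (ip (defect ip B (u i)) v
                             + (qform B (u i))%:C * ip (u i) v).
  rewrite /y /oproj linear_op_sum // ip_suml //; apply: eq_bigr => i _.
  by rewrite linear_opZ // ipZl // -(ipZl Hip (qform B (u i))%:C) -(ipDl Hip) subrK.
have fx : qform B x = qform B y + 2 * complex.Re (ip (B y) z) + qform B z.
  by rewrite -qformD // addrC subrK.
have -> : qform B x - (\sum_(i < m) qform B (u i) * sqmod (ip x (u i)) + qform B z) =
   \sum_(i < m) complex.Re (ip x (u i) * ip (defect ip B (u i)) (x + z)).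
  rewrite fx {1}/qform !By !cRe_sum.
  apply/eqP; rewrite subr_eq; apply/eqP; rewrite addrA; congr (_ + _).
  rewrite mulr_sumr -!big_split /=; apply: eq_bigr => i _.
  have -> : ip (u i) z = 0 by rewrite (ip_conj Hip z) zu // rmorph0.
  have -> : ip (u i) y = conjc (ip x (u i)) by rewrite (ip_conj Hip y) ip_proj.
  have -> : x + z = y + z + z by rewrite [y + z]addrC subrK.
  set c := ip x (u i); set d := defect ip B (u i); set l := qform B (u i).
  have cc : complex.Re (c * (l%:C * conjc c)) = l * sqmod c.
    by rewrite mulrCA mul_conj cReM /= mul0r subr0.
  rewrite mulr0 addr0 !(ipDr Hip) !(mulrDr c) !cReD cc; lra.
rewrite (le_trans (ler_norm_sum _ _ _)) //.
rewrite -mulrA -[m in m%:R]card_ord -sumr_const mulr_suml ler_sum // => i _; rewrite mul1r.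
have yz : complex.Re (ip y z) = 0.
  rewrite /y /oproj ip_suml // cRe_sum big1 // => j _.
  by rewrite ipZl // (ip_conj Hip z) zu // rmorph0 mulr0.
have hxz : sqnorm (x + z) <= 4 * sqnorm x.
  have {1}-> : x = y + z by rewrite addrC subrK.
  have -> : sqnorm x = sqnorm y + sqnorm z.
    by rewrite -[x](subrK y) addrC sqnormD // yz mulr0 addr0.
  rewrite (sqnormD Hip (y + z)) (sqnormD Hip y) ipDl // cReD yz.
  rewrite -/(sqnorm z); have := sqnorm_ge0 Hip y; lra.
have h1 : sqmod (ip x (u i)) <= sqnorm x.
  by rewrite (le_trans (cauchy_schwarz Hip _ _)) // (orthonormal_sqnorm on) // mulr1.
have h2 : sqmod (ip (defect ip B (u i)) (x + z)) <= e ^+ 2 * (4 * sqnorm x).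
  rewrite (le_trans (cauchy_schwarz Hip _ _)) // ler_pM ?sqnorm_ge0 ?ud //.
(* The weight [2 e] in AM-GM balances [sqnorm x] against [e^2 (4 sqnorm x)]. *)
have e2 : 0 < 2 * e by lra.
rewrite (le_trans (abs_Re_mul_le _ _ e2)) //.
have h3 : (2 * e)^-1 * sqmod (ip (defect ip B (u i)) (x + z)) <= 2 * e * sqnorm x.
  by rewrite mulrC ler_pdivrMr //; lra.
have h4 : 2 * e * sqmod (ip x (u i)) <= 2 * e * sqnorm x by rewrite ler_pM2l.
lra.
Qed.

(** [u k] is orthogonal to the vectors before [u i], hence a competitor in the choice of [u i]. *)
Lemma approx_eigen_noninc n (e : R) u i k : approx_eigenbasis ip B n e u -> 0 <= e ->
  (i <= k)%N -> (k < n)%N -> qform B (u k) <= qform B (u i) + e.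
Proof.
move=> [on _ um] e0; rewrite leq_eqVlt => /predU1P[->|ik] kn; first by rewrite lerDl.
have iN := ltn_trans ik kn.
have := um i (u k) iN; rewrite (orthonormal_sqnorm on) // mulr1; apply=> j ji.
have jk := ltn_trans ji ik.
by rewrite on ?(ltn_trans jk kn) // (gtn_eqF jk).
Qed.

(** The competitor of rank [k] is [B] truncated to the first [k] approximate eigenvectors. Up to the
    diagonalization error [2 n e], the form of the remainder is that of [B] on their orthogonal
    complement, where near maximality of [u k] costs one more [e]. *)
Lemma singnum_le_eigen n (e : R) u k : 0 < e -> approx_eigenbasis ip B n e u -> (k < n)%N ->
  mu k <= qform B (u k) + (1 + 2 * n%:R) * e.
Proof.
move=> e0 [on ud um] kn; have onk := orthonormal_le (ltnW kn) on.
pose lam i := qform B (u i).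
pose F x := \sum_(i < k) (lam i)%:C *: (ip x (u i) *: u i).
have linF : linear_op F.
  move=> a x y; rewrite /F scaler_sumr -big_split /=; apply: eq_bigr => i _.
  by rewrite ip_linear // !scalerA -scalerDl; congr (_ *: _); ring.
have linT : linear_op (fun x => B x - F x).
  by move=> a x y; rewrite linB linF scalerBr; rewrite opprD addrACA.
have ipF x : ip (F x) x = (\sum_(i < k) lam i * sqmod (ip x (u i)))%:C.
  rewrite /F ip_suml // rmorph_sum /=; apply: eq_bigr => i _.
  by rewrite !ipZl // (ip_conj Hip x) mul_conj rmorphM.
have formT x : qform (fun x => B x - F x) x =
    qform B x - \sum_(i < k) lam i * sqmod (ip x (u i)).
  by rewrite /qform ipBl // ipF cReD cReN.
set c := _ + _.
have lk0 : 0 <= lam k by exact: pos_ge0 posB _.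
have n0 : (0 : R) <= n%:R by rewrite ler0n.
have c0 : 0 < c.
  by rewrite ltr_wpDl // mulr_gt0 //; lra.
apply: (singnum_le snB linF); [|exact: ltW|].
  exists (fun i => u i) => x; exists (fun i => (lam i)%:C * ip x (u i)).
  by apply: eq_bigr => i _; rewrite scalerA.
move=> x; apply: (sqnorm_le_of_form Hip linT _ c0) => {}x.
  by rewrite ipBl // ipF; have := imB x; case: (ip _ _) => p q /= ->; rewrite subr0.
rewrite formT; have := form_approx_diagonal x e0 onk (fun i ik => ud i (ltn_trans ik kn)).
set S := \sum_(i < k) _; set z := x - _.
have z0 : 0 <= qform B z by exact: pos_ge0 posB _.
have zx : sqnorm z <= sqnorm x.
  by rewrite sqnorm_sub_proj // gerBl sumr_ge0 // => i _; exact: sqmod_ge0.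
have hz : qform B z <= (lam k + e) * sqnorm x.
  apply: le_trans (um k z kn _) _; first by move=> i ik; rewrite ip_sub_proj.
  by rewrite ler_wpM2l // addr_ge0 // ltW.
have hk : k%:R * (2 * e) * sqnorm x <= n%:R * (2 * e) * sqnorm x.
  rewrite ler_wpM2r ?sqnorm_ge0 // ler_wpM2r ?ler_nat ?(ltnW kn) //; lra.
have -> : c * sqnorm x = (lam k + e) * sqnorm x + n%:R * (2 * e) * sqnorm x.
  by rewrite /c -/(lam k); ring.
rewrite !ler_norml => /andP[h1 h2]; apply/andP; split; lra.
Qed.

(** The lower half of the min-max principle: an operator [F] of rank [k] kills some nonzero x in
    this space of dimension [k.+1], and there <Bx, x> = <(B - F)x, x>. *)
Lemma le_singnum k (l : R) u : orthonormal_fam k.+1 u ->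
  (forall (a : nat -> R[i]) x, x = \sum_(i < k.+1) a i *: u i ->
     l * sqnorm x <= qform B x) -> l <= mu k.
Proof.
move=> on h; apply/ler_addgt0Pr => e e0.
have [F [linF rF hF]] := singnum_approx snB k e0.
have [a [[i ik ai] Fa]] := finite_rank_kernel u linF rF.
have := h a _ erefl; set x := \sum_(i < k.+1) _ in Fa * => hx.
have x0 : 0 < sqnorm x.
  apply: sqnorm_gt0 => //; apply: contra_neq ai => x0.
  by rewrite -(ip_combination Hip a on ik) -/x x0 ip0l.
have fx : qform B x = complex.Re (ip (B x - F x) x) by rewrite Fa subr0.
have me : 0 <= mu k + e by rewrite addr_ge0 ?(singnum_ge0 snB) // ltW.
rewrite -(ler_pM2r x0) (le_trans hx) // fx.
have hs : complex.Re (ip (B x - F x) x) ^+ 2 <= ((mu k + e) * sqnorm x) ^+ 2.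
  apply: le_trans (_ : _ <= sqmod (ip (B x - F x) x)) _; first by rewrite lerDl sqr_ge0.
  apply: le_trans (cauchy_schwarz Hip _ _) _.
  by rewrite exprMn [sqnorm x ^+ 2]expr2 mulrA ler_wpM2r // ltW.
apply: le_trans (ler_norm _) _; have := ler_wsqrtr hs; rewrite !sqrtr_sqr.
by rewrite [leRHS]ger0_norm // mulr_ge0 // ltW.
Qed.

(** The span of [u 0], ..., [u k] is a test space for [le_singnum]: by [approx_eigen_noninc] all the
    diagonal values there are at least that of [u k] minus [e]. *)
Lemma eigen_le_singnum n (e : R) u k : 0 < e -> approx_eigenbasis ip B n e u -> (k < n)%N ->
  qform B (u k) <= mu k + (1 + 2 * n%:R) * e.
Proof.
move=> e0 bas kn; have [on ud um] := bas; have onk := orthonormal_le kn on.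
rewrite -lerBlDr; apply: (le_singnum onk) => a x xE.
have := form_approx_diagonal x e0 onk (fun i ik => ud i (leq_trans ik kn)).
have z0 : 0 <= qform B (x - oproj k.+1 u x) by exact: pos_ge0 posB _.
have nx : sqnorm x = \sum_(i < k.+1) sqmod (a i) by rewrite xE sqnorm_combination.
have hS : (qform B (u k) - e) * sqnorm x <=
    \sum_(i < k.+1) qform B (u i) * sqmod (ip x (u i)).
  rewrite nx mulr_sumr ler_sum // => i _; rewrite xE ip_combination // ler_wpM2r ?sqmod_ge0 //.
  by rewrite lerBlDr; apply: approx_eigen_noninc bas _ _ kn; [exact: ltW|rewrite -ltnS].
have hk : k.+1%:R * (2 * e) * sqnorm x <= n%:R * (2 * e) * sqnorm x.
  by rewrite ler_wpM2r ?sqnorm_ge0 // ler_wpM2r ?ler_nat //; lra.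
rewrite ler_norml => /andP[h1 h2]; lra.
Qed.

(** For m = k + 1, split off [u i] for i < k and estimate the form on their complement by [lam k].
    The trace is then at most (k + 1) lam k + sum_(i < k) (lam i - lam k) s_i up to errors, where
    s_i, the sum over j of [s i j], is at most 1 by Bessel. This is bounded by the sum of the first
    k + 1 values of [lam]. *)
Lemma trace_le_singnum m w : orthonormal_fam m w ->
  \sum_(j < m) qform B (w j) <= \sum_(k < m) mu k.
Proof.
case: m => [|k] ow; first by rewrite !big_ord0.
pose N : R := k.+1%:R; have N0 : 0 <= N by rewrite ler0n.
apply: (@le_of_le_addM _ _ _ (N * (1 + 2 * N) + N * (1 + 2 * N) + N)) => [|e e0].
  by rewrite !addr_ge0 ?mulr_ge0 //; lra.
have [u bas] := greedy Hip posB infdim k.+1 e0; have [on ud um] := bas.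
have onk := orthonormal_le (leqnSn k) on.
pose lam i := qform B (u i); pose s i j := sqmod (ip (w j) (u i)).
have hj j : (j < k.+1)%N -> qform B (w j) <=
    lam k + (1 + 2 * N) * e + \sum_(i < k) (lam i - lam k - e) * s i j.
  move=> jk; have := form_approx_diagonal (w j) e0 onk (fun i ik => ud i (leqW ik)).
  have := um k (w j - oproj k u (w j)) (leqnn _) (fun i ik => ip_sub_proj Hip _ onk ik).
  rewrite sqnorm_sub_proj // (orthonormal_sqnorm ow jk) ler_norml => h1 /andP[_ h2].
  have -> : \sum_(i < k) (lam i - lam k - e) * s i j =
      \sum_(i < k) lam i * s i j - (lam k + e) * \sum_(i < k) s i j.
    by rewrite mulr_sumr -sumrB; apply: eq_bigr => i _; ring.
  have : k%:R * (2 * e) * 1 <= N * (2 * e) by rewrite mulr1 ler_wpM2r ?ler_nat //; lra.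
  rewrite -/(lam k) in h1; move: h1 h2; rewrite -/(s _ _); lra.
have hsum : \sum_(j < k.+1) qform B (w j) <=
    \sum_(j < k.+1) (lam k + (1 + 2 * N) * e + \sum_(i < k) (lam i - lam k - e) * s i j).
  by rewrite ler_sum // => j _; exact: hj.
rewrite big_split /= sum_const_ord exchange_big /= in hsum.
have hi (i : 'I_k) : \sum_(j < k.+1) (lam i - lam k - e) * s i j <= lam i - lam k + e.
  rewrite -mulr_sumr; have b0 : 0 <= \sum_(j < k.+1) s i j.
    by rewrite sumr_ge0 // => j _; exact: sqmod_ge0.
  have b1 : \sum_(j < k.+1) s i j <= 1.
    rewrite -(orthonormal_sqnorm onk (ltn_ord i)); apply: le_trans (bessel Hip (u i) ow).
    by rewrite ler_sum // => j _; rewrite /s sqmod_ipC.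
  (* [lam] is nonincreasing only up to [e]; adding [e] restores the sign needed to use [b1]. *)
  have li : 0 <= lam i - lam k + e.
    have := approx_eigen_noninc bas (ltW e0) (ltnW (ltn_ord i)) (leqnn _).
    by rewrite -/(lam i) -/(lam k); lra.
  apply: le_trans (_ : _ <= (lam i - lam k + e) * \sum_(j < k.+1) s i j) _.
    by rewrite ler_wpM2r //; lra.
  by rewrite ler_piMr.
have hl : \sum_(i < k.+1) lam i <= \sum_(i < k.+1) mu i + N * ((1 + 2 * N) * e).
  rewrite -[N * _]sum_const_ord -big_split /= ler_sum // => i _.
  exact: (eigen_le_singnum e0 bas (ltn_ord i)).
have hh : \sum_(i < k) \sum_(j < k.+1) (lam i - lam k - e) * s i j <=
    \sum_(i < k) lam i - k%:R * lam k + k%:R * e.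
  rewrite -!sum_const_ord -sumrB -big_split /= ler_sum // => i _; exact: hi.
have Nk : N = k%:R + 1 by rewrite /N -natr1.
have hl' : \sum_(i < k.+1) lam i = \sum_(i < k) lam i + lam k by rewrite big_ord_recr.
have ke : k%:R * e <= N * e by rewrite ler_wpM2r ?ler_nat // ltW.
rewrite -/N in hsum.
have e1 : N * (lam k + (1 + 2 * N) * e) = N * lam k + N * (1 + 2 * N) * e by ring.
have e2 : N * lam k = k%:R * lam k + lam k by rewrite Nk; ring.
rewrite !mulrDl; lra.
Qed.

(** The list [s] consists of approximate eigenvectors. If [w] spans them, their weights along [w]
    add up to 1, so the trace over [w] is at least the sum of their diagonal values up to errors.
    Allowing every such [w] lets one family serve two operators at once. *)
Lemma singnum_le_trace n (e : R) : 0 < e -> exists2 s : seq E, size s = n &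
  forall m w, orthonormal_fam m w -> (forall x, x \in s -> in_span_of ip m w x) ->
  \sum_(k < n) mu k <= \sum_(j < m) qform B (w j) + m.+1%:R * e.
Proof.
move=> e0; pose N : R := n%:R; have N0 : 0 <= N by rewrite ler0n.
(* Makes both errors, [N (1 + 2 N) d] from the singular numbers and [2 N d] for each vector of [w],
   at most [e]. *)
pose C := N * (1 + 2 * N) + 2 * N + 1.
have C0 : 0 < C by rewrite ltr_wpDl // addr_ge0 ?mulr_ge0 //; lra.
pose d := e / C; have d0 : 0 < d by rewrite divr_gt0.
have dE : C * d = e by rewrite mulrC mulfVK // gt_eqF.
have [u bas] := greedy Hip posB infdim n d0; have [on ud um] := bas.
exists (mkseq u n) => [|m w ow ws]; first by rewrite size_mkseq.
pose lam i := qform B (u i).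
have hj j : (j < m)%N ->
    \sum_(i < n) lam i * sqmod (ip (w j) (u i)) <= qform B (w j) + N * (2 * d).
  move=> jm; have := form_approx_diagonal (w j) d0 on ud.
  have := pos_ge0 posB (w j - oproj n u (w j)).
  rewrite (orthonormal_sqnorm ow jm) mulr1 ler_norml => h1 /andP[h2 _].
  by move: h2; rewrite -/N; lra.
have hsum : \sum_(j < m) \sum_(i < n) lam i * sqmod (ip (w j) (u i)) <=
    \sum_(j < m) (qform B (w j) + N * (2 * d)).
  by rewrite ler_sum // => j _; exact: hj.
rewrite big_split /= sum_const_ord exchange_big /= in hsum.
have hl : \sum_(i < n) \sum_(j < m) lam i * sqmod (ip (w j) (u i)) = \sum_(i < n) lam i.
  apply: eq_bigr => i _; rewrite -mulr_sumr -[RHS]mulr1 -(orthonormal_sqnorm on (ltn_ord i)).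
  rewrite -(ws (u i)); first by congr (_ * _); apply: eq_bigr => j _; rewrite sqmod_ipC.
  by apply/mapP; exists (i : nat) => //; rewrite mem_iota /= ltn_ord.
rewrite hl in hsum.
have hm : \sum_(i < n) mu i <= \sum_(i < n) lam i + N * ((1 + 2 * N) * d).
  rewrite -[N * _]sum_const_ord -big_split /= ler_sum // => i _.
  exact: (singnum_le_eigen d0 bas (ltn_ord i)).
have M0 : (0 : R) <= m%:R by rewrite ler0n.
have p1 : 0 <= N * (1 + 2 * N) * d by apply: mulr_ge0; [apply: mulr_ge0 => //; lra|exact: ltW].
have p2 : 0 <= N * d by rewrite mulr_ge0 // ltW.
have eE : e = N * (1 + 2 * N) * d + 2 * (N * d) + d by rewrite -dE /C; ring.
have h1 : m%:R * (N * (2 * d)) <= m%:R * e by rewrite ler_wpM2l // eE; lra.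
have h2 : N * ((1 + 2 * N) * d) <= e by rewrite eE; lra.
rewrite -natr1 mulrDl mul1r; lra.
Qed.

End OneOperator.

(* Compress to the span of approximate eigenvectors of both operators on the left. *)
Lemma singnum_sum_le (B1 B2 B3 B4 : E -> E) (mu1 mu2 mu3 mu4 : nat -> R) n :
  positive_op ip B1 -> positive_op ip B2 -> positive_op ip B3 -> positive_op ip B4 ->
  singular_numbers B1 mu1 -> singular_numbers B2 mu2 ->
  singular_numbers B3 mu3 -> singular_numbers B4 mu4 ->
  (forall x, qform B1 x + qform B2 x = qform B3 x + qform B4 x) ->
  \sum_(k < n) mu1 k + \sum_(k < n) mu2 k <=
  \sum_(k < n + n) mu3 k + \sum_(k < n + n) mu4 k.
Proof.
move=> p1 p2 p3 p4 s1 s2 s3 s4 hq.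
apply: (@le_of_le_addM _ _ _ (2 * (n + n).+1%:R)) => [|e e0]; first by rewrite mulr_ge0 ?ler0n.
have [r1 z1 h1] := singnum_le_trace p1 s1 n e0.
have [r2 z2 h2] := singnum_le_trace p2 s2 n e0.
(* Two lists of [n] vectors span at most [n + n] dimensions, whence the length of the sums on the
   right. *)
have [m [w [mn ow hw]]] := gram_schmidt Hip (r1 ++ r2).
rewrite size_cat z1 z2 in mn.
have {}h1 : \sum_(k < n) mu1 k <= \sum_(j < m) qform B1 (w j) + m.+1%:R * e.
  by apply: h1 => // x xs; apply: hw; rewrite mem_cat xs.
have {}h2 : \sum_(k < n) mu2 k <= \sum_(j < m) qform B2 (w j) + m.+1%:R * e.
  by apply: h2 => // x xs; apply: hw; rewrite mem_cat xs orbT.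
have h3 := trace_le_singnum p3 s3 ow; have h4 := trace_le_singnum p4 s4 ow.
have hs B mu : singular_numbers B mu -> \sum_(k < m) mu k <= \sum_(k < n + n) mu k.
  move=> sB; rewrite -!(big_mkord xpredT mu) (big_cat_nat (leq0n m) mn) /= lerDl sumr_ge0 // => i _.
  exact: singnum_ge0 sB i.
have h34 : \sum_(j < m) qform B1 (w j) + \sum_(j < m) qform B2 (w j) =
    \sum_(j < m) qform B3 (w j) + \sum_(j < m) qform B4 (w j).
  by rewrite -!big_split /=; apply: eq_bigr => j _; exact: hq.
have hm : m.+1%:R * e <= (n + n).+1%:R * e by rewrite ler_wpM2r ?ler_nat ?ltW.
have := hs _ _ s3; have := hs _ _ s4; lra.
Qed.

End SingularNumbers.

(** * Operators on l^2 and their singular values *)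

Section L2Space.
Variable R : realType.
Local Notation C := R[i].
Implicit Types x y z : vec R.

Definition cvgC (u : nat -> C) (l : C) :=
  (fun N => complex.Re (u N)) @ \oo --> complex.Re l /\
  (fun N => complex.Im (u N)) @ \oo --> complex.Im l.

Lemma cvgC_unique u l l' : cvgC u l -> cvgC u l' -> l = l'.
Proof.
by move=> [a b] [a' b']; apply: complex_eqP; [exact: cvg_unique a a'|exact: cvg_unique b b'].
Qed.

Lemma cvgC_linear a u v l l' : cvgC u l -> cvgC v l' ->
  cvgC (fun N => a * u N + v N) (a * l + l').
Proof.
move=> [ur ui] [vr vi]; split.
  rewrite cReD cReM; under eq_fun do rewrite cReD cReM.
  by apply: cvgD => //; apply: cvgB; apply: cvgMl_tmp.
rewrite cImD cImM; under eq_fun do rewrite cImD cImM.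
by apply: cvgD => //; apply: cvgD; apply: cvgMl_tmp.
Qed.

Lemma cvgC_conj u l : cvgC u l -> cvgC (fun N => conjc (u N)) (conjc l).
Proof.
move=> [ur ui]; split.
  by rewrite cRe_conj; under eq_fun do rewrite cRe_conj.
by rewrite cIm_conj; under eq_fun do rewrite cIm_conj; exact: cvgN.
Qed.

Lemma psum2_nondecreasing x : nondecreasing_seq (psum2 x).
Proof.
apply/nondecreasing_seqP => n; rewrite /psum2 big_ord_recr /= lerDl; exact: sqmod_ge0.
Qed.

Lemma psum2_cvg x : l2 x -> psum2 x @ \oo --> sup (range (psum2 x)).
Proof.
move=> [B hB]; apply: nondecreasing_cvgn; first exact: psum2_nondecreasing.
by exists B => _ [n _ <-].
Qed.

Lemma psum2_le_sup x n : l2 x -> psum2 x n <= sup (range (psum2 x)).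
Proof.
by move=> [B hB]; apply: ub_le_sup; [exists B => _ [m _ <-]|exists n].
Qed.

Lemma l2_linear (a : C) x y : l2 x -> l2 y -> l2 (fun k => a * x k + y k).
Proof.
move=> [B hB] [D hD]; exists (2 * (sqmod a * B) + 2 * D) => N.
apply: le_trans (_ : _ <= 2 * (sqmod a * psum2 x N) + 2 * psum2 y N) _; last first.
  by rewrite lerD // ler_wpM2l // ler_wpM2l ?sqmod_ge0.
rewrite /psum2 !mulr_sumr -big_split /= ler_sum // => k _; rewrite -sqmodM.
rewrite /sqmod cReD cImD; set p := complex.Re (a * _); set q := complex.Im (a * _).
set p' := complex.Re (y k); set q' := complex.Im (y k).
have := sqr_ge0 (p - p'); have := sqr_ge0 (q - q').
by rewrite !sqrrB !sqrrD; lra.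
Qed.

Lemma l2_0 : l2 (fun=> 0 : C).
Proof. by exists 0 => N; rewrite /psum2 big1 // => k _; exact: sqmod0. Qed.

(** Polarization reduces the convergence of inner products to that of the monotone sums [psum2]. The
    factor [1 *] matches the form of [l2_linear]. *)
Lemma Re_inner_psum x y N : complex.Re (inner_psum x y N) =
  (psum2 (fun k => 1 * x k + y k) N - psum2 x N - psum2 y N) / 2.
Proof.
rewrite /inner_psum /psum2 cRe_sum -!sumrB mulr_suml; apply: eq_bigr => k _.
by rewrite mul1r /sqmod cReM cReD cImD cRe_conj cIm_conj; field.
Qed.

(** The product is conjugate linear in its second argument, and conjugating ['i] turns the imaginary
    part into a real part. The summand 0 again matches [l2_linear]. *)
Lemma Im_inner_psum x y N : complex.Im (inner_psum x y N) =
  complex.Re (inner_psum x (fun k => 'i * y k + 0) N).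
Proof.
rewrite /inner_psum cRe_sum cIm_sum; apply: eq_bigr => k _.
by rewrite addr0 cReM cImM !cRe_conj !cIm_conj cReM cImM /=; ring.
Qed.

Definition l2ip x y : C := lim ((fun N => complex.Re (inner_psum x y N)) @ \oo)
  +i* lim ((fun N => complex.Im (inner_psum x y N)) @ \oo).

Lemma l2ip_cvg x y : l2 x -> l2 y -> cvgC (inner_psum x y) (l2ip x y).
Proof.
move=> hx hy.
have h z : l2 z -> cvgn (fun N => complex.Re (inner_psum x z N)).
  move=> hz; under eq_fun do rewrite Re_inner_psum.
  apply/cvg_ex; eexists; apply: cvgMr_tmp; apply: cvgB; first apply: cvgB.
  - exact: psum2_cvg (l2_linear 1 hx hz).
  - exact: psum2_cvg.
  - exact: psum2_cvg.
split; first exact: h.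
have ImE : (fun N => complex.Im (inner_psum x y N)) =
    (fun N => complex.Re (inner_psum x (fun k => 'i * y k + 0) N)).
  by apply/funext => N; exact: Im_inner_psum.
by rewrite /l2ip /= ImE; apply: h; exact: l2_linear hy l2_0.
Qed.

Lemma l2ip_linear a x y z : l2 x -> l2 y -> l2 z ->
  l2ip (fun k => a * x k + y k) z = a * l2ip x z + l2ip y z.
Proof.
move=> hx hy hz; apply: cvgC_unique (l2ip_cvg (l2_linear a hx hy) hz) _.
have -> : inner_psum (fun k => a * x k + y k) z =
    fun N => a * inner_psum x z N + inner_psum y z N.
  apply/funext => N; rewrite /inner_psum mulr_sumr -big_split; apply: eq_bigr => k _ /=.
  by rewrite mulrDl mulrA.
by apply: cvgC_linear; exact: l2ip_cvg.
Qed.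

Lemma l2ip_conj x y : l2 x -> l2 y -> l2ip y x = conjc (l2ip x y).
Proof.
move=> hx hy; apply: cvgC_unique (l2ip_cvg hy hx) _.
have -> : inner_psum y x = fun N => conjc (inner_psum x y N).
  apply/funext => N; rewrite /inner_psum rmorph_sum /=; apply: eq_bigr => k _.
  by rewrite rmorphM /= conjcK mulrC.
by apply: cvgC_conj; exact: l2ip_cvg.
Qed.

Lemma l2ip_self x : l2 x -> l2ip x x = (sup (range (psum2 x)))%:C.
Proof.
move=> hx; apply: cvgC_unique (l2ip_cvg hx hx) _.
have hN N : inner_psum x x N = (psum2 x N)%:C.
  by rewrite /psum2 rmorph_sum; apply: eq_bigr => k _; rewrite mul_conj.
split; under eq_fun do rewrite hN; rewrite /=; first exact: psum2_cvg.
exact: cvg_cst.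
Qed.

Definition delta (k : nat) : vec R := fun j => (j == k)%:R.

Lemma l2_delta k : l2 (delta k).
Proof.
exists 1 => N; rewrite /psum2 /delta.
have [kN|kN] := ltnP k N.
  rewrite (bigD1 (Ordinal kN)) //= eqxx big1 => [|i /negPf h].
    by rewrite /sqmod /= expr1n expr0n !addr0.
  by rewrite (_ : (_ == _) = false) ?sqmod0 //; apply: contraFF h => /eqP h; apply/eqP/val_inj.
rewrite big1 // => i _; rewrite ltn_eqF ?sqmod0 //; exact: leq_trans kN.
Qed.

Lemma l2ip_delta x k : l2 x -> l2ip x (delta k) = x k.
Proof.
move=> hx; apply: cvgC_unique (l2ip_cvg hx (l2_delta k)) _.
have h N : (k < N)%N -> inner_psum x (delta k) N = x k.
  move=> kN; rewrite /inner_psum /delta (bigD1 (Ordinal kN)) //= eqxx.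
  rewrite rmorph1 mulr1 big1 ?addr0 // => i /negPf h.
  by rewrite (_ : (_ == _) = false) ?mulr0n ?rmorph0 ?mulr0 //.
by split; apply: cvg_near_cst; exists k.+1 => // N /= kN; rewrite h.
Qed.

(** Square-summable sequences are bundled as a submodule so that the results on an abstract
    [lmodType] apply to them. *)
Definition l2pred : {pred nat -> C} := fun x => `[< l2 x >].

Lemma l2_submod_closed : submod_closed l2pred.
Proof.
split; first by apply/asboolP; exact: l2_0.
by move=> a x y /asboolP hx /asboolP hy; apply/asboolP; exact: l2_linear.
Qed.

HB.instance Definition _ := GRing.isSubmodClosed.Build C (nat -> C) l2pred l2_submod_closed.

Record l2T := L2T { l2val :> nat -> C; _ : l2val \in l2pred }.
HB.instance Definition _ := [isSub for l2val].
HB.instance Definition _ := [Choice of l2T by <:].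
HB.instance Definition _ := [SubChoice_isSubLmodule of l2T by <:].

Implicit Types v w : l2T.

Lemma l2valP v : l2 v. Proof. by case: v => x /= /asboolP. Qed.

Definition toL2 x (hx : l2 x) : l2T := L2T (asboolT hx).

Definition ipT v w : C := l2ip v w.

Lemma l2T_inner_product : inner_product ipT.
Proof.
split.
- by move=> a v w z; exact: (l2ip_linear a (l2valP v) (l2valP w) (l2valP z)).
- by move=> v w; exact: (l2ip_conj (l2valP v) (l2valP w)).
- move=> v; rewrite /ipT l2ip_self /=; last exact: l2valP.
  apply: le_trans (psum2_le_sup 0 (l2valP v)).
  by rewrite /psum2 big_ord0.
move=> v; rewrite /ipT l2ip_self /=; last exact: l2valP.
move=> h; apply/val_inj/funext => k /=.
apply: sqmod_eq0; apply/eqP; rewrite eq_le sqmod_ge0 andbT.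
apply: le_trans (_ : psum2 v k.+1 <= _); last by rewrite -[leRHS]h; exact: psum2_le_sup (l2valP v).
by rewrite /psum2 big_ord_recr /= lerDr sumr_ge0 // => i _; exact: sqmod_ge0.
Qed.

Let Hip := l2T_inner_product.

Lemma sqnormT v : sqnorm ipT v = sup (range (psum2 v)).
Proof. by rewrite /sqnorm /ipT l2ip_self //; exact: l2valP. Qed.

Lemma norm2T v : norm2 v = Num.sqrt (sqnorm ipT v).
Proof. by rewrite sqnormT. Qed.

Definition deltaT k := toL2 (l2_delta k).

Lemma ipT_delta v k : ipT v (deltaT k) = l2val v k.
Proof. exact: l2ip_delta (l2valP v). Qed.

Lemma orthonormal_deltaT n : orthonormal_fam ipT n deltaT.
Proof. by move=> i j _ _; rewrite ipT_delta /= /delta eq_sym. Qed.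

(** The operator sending v to the combination of the first [n] basis vectors with coefficients <v, u
    i> has rank at most [n], so it kills a nonzero combination of [n.+1] basis vectors; being killed
    means being orthogonal to every [u i]. *)
Lemma l2T_infdim n (u : nat -> l2T) : exists v, sqnorm ipT v = 1 /\
  forall i, (i < n)%N -> ipT v (u i) = 0.
Proof.
pose F v := \sum_(i < n) ipT v (u i) *: deltaT i.
have linF : linear_op F.
  move=> a v w; rewrite /F scaler_sumr -big_split; apply: eq_bigr => i _ /=.
  by rewrite ip_linear // scalerDl scalerA.
have [|a [[i iN ai] Fa]] := finite_rank_kernel deltaT linF (k := n).
  by exists (fun i => deltaT i) => v; exists (fun i => ipT v (u i)).
move: Fa; set x := \sum_(i < n.+1) _ => Fa.
have x0 : 0 < sqnorm ipT x.
  apply: sqnorm_gt0 => //; apply: contra_neq ai => x0.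
  by rewrite -(ip_combination Hip a (@orthonormal_deltaT n.+1) iN) -/x x0 ip0l.
have xu j : (j < n)%N -> ipT x (u j) = 0.
  move=> jn; have := ip_combination Hip (fun i => ipT x (u i)) (@orthonormal_deltaT n) jn.
  by rewrite -/(F x) Fa ip0l.
pose q := (Num.sqrt (sqnorm ipT x))^-1.
exists (q%:C *: x); split=> [|j jn]; last by rewrite ipZl // xu // mulr0.
by rewrite sqnormZ // sqmod_real exprVn sqr_sqrtr ?mulVf ?gt_eqF // ltW.
Qed.

Section Lift.
Variables (T : op R) (hT : is_bounded_op T).

Definition liftT v : l2T := toL2 (let: And3 h _ _ := hT in h v (l2valP v)).

Lemma liftTE v : l2val (liftT v) = T v. Proof. by []. Qed.

Lemma liftT_linear : linear_op liftT.
Proof.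
move=> a v w; apply: val_inj => /=; case: hT => _ h _.
exact: (h a _ _ (l2valP v) (l2valP w)).
Qed.

Lemma liftT_bounded : exists2 c, 0 <= c & forall v, sqnorm ipT (liftT v) <= c ^+ 2 * sqnorm ipT v.
Proof.
case: (hT) => _ _ [c hc]; exists `|c| => // v; have := hc v (l2valP v).
rewrite -liftTE !norm2T => h.
have h2 : Num.sqrt (sqnorm ipT (liftT v)) <= `|c| * Num.sqrt (sqnorm ipT v).
  by rewrite (le_trans h) // ler_wpM2r ?sqrtr_ge0 // ler_norm.
have := lerXn2r 2 (sqrtr_ge0 _ : _ \is Num.nneg) (mulr_ge0 (normr_ge0 c) (sqrtr_ge0 _) : _ \is Num.nneg) h2.
by rewrite exprMn !sqr_sqrtr ?sqnorm_ge0.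
Qed.

Lemma liftT_positive : is_pos_op T -> positive_op ipT liftT.
Proof.
move=> [_ hp]; have hr v : exists2 r : R, 0 <= r & ipT (liftT v) v = r%:C.
  have [r [r0 [h1 h2]]] := hp v (l2valP v); exists r => //.
  have h : cvgC (inner_psum (liftT v) v) r%:C by split.
  exact: cvgC_unique (l2ip_cvg (l2valP (liftT v)) (l2valP v)) h.
split.
- exact: liftT_linear.
- by move=> v; have [r _ ->] := hr v.
- by move=> v; rewrite /qform; have [r r0 ->] := hr v.
(* Expanding 0 <= |Tv - v|^2 gives 2 <Tv, v> <= |Tv|^2 + |v|^2. *)
have [c c0 hc] := liftT_bounded; exists ((c ^+ 2 + 1) / 2) => v.
have := sqnorm_ge0 Hip (liftT v - v); rewrite sqnormD // ipNr // cReN sqnormN // -/(qform _ _ _).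
have := hc v; lra.
Qed.

End Lift.

Lemma norm2_le (T : op R) (hT : is_bounded_op T) (c : R) : 0 <= c ->
  (forall v, sqnorm ipT (liftT hT v) <= c ^+ 2 * sqnorm ipT v) ->
  forall x, l2 x -> norm2 (T x) <= c * norm2 x.
Proof.
move=> c0 h x hx; have := ler_wsqrtr (h (toL2 hx)); rewrite sqrtrM ?sqr_ge0 //.
by rewrite sqrtr_sqr (ger0_norm c0) -!norm2T.
Qed.

Lemma is_bounded_op_sub (A B : op R) : is_bounded_op A -> is_bounded_op B ->
  is_bounded_op (opsub A B).
Proof.
move=> hA hB.
have l2E x (hx : l2 x) : opsub A B x = l2val (liftT hA (toL2 hx) - liftT hB (toL2 hx)) by [].
split.
- by move=> x hx; rewrite l2E; exact: l2valP.
- move=> a x y hx hy; apply/funext => k; rewrite /opsub.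
  by case: (hA) => _ -> // _; case: (hB) => _ -> // _; ring.
have [c c0 hc] := liftT_bounded hA; have [d d0 hd] := liftT_bounded hB.
(* From |a - b|^2 <= 2 |a|^2 + 2 |b|^2. *)
exists (Num.sqrt (2 * c ^+ 2 + 2 * d ^+ 2)) => x hx; set v := toL2 hx.
rewrite l2E norm2T (_ : norm2 x = norm2 v) // norm2T -sqrtrM; last first.
  by rewrite addr_ge0 // mulr_ge0 ?sqr_ge0.
apply: ler_wsqrtr; have := hc v; have := hd v.
have := sqnorm_ge0 Hip (liftT hA v + liftT hB v); rewrite !sqnormD // sqnormN // ipNr // cReN.
rewrite -/v; lra.
Qed.

Lemma opnorm_le (T : op R) (c : R) : 0 <= c ->
  (forall x, l2 x -> norm2 (T x) <= c * norm2 x) -> opnorm T <= c.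
Proof.
move=> c0 h; apply: ge_sup.
  exists (norm2 (T (fun=> 0))), (fun=> 0) => //; split; first exact: l2_0.
  by rewrite (norm2T 0) sqnorm0 // sqrtr0.
move=> _ [x [hx x1] <-]; rewrite (le_trans (h x hx)) // ler_piMr //.
Qed.

Lemma norm2_ge0 x : 0 <= norm2 x. Proof. exact: sqrtr_ge0. Qed.

Lemma opnorm_ge0 (T : op R) : 0 <= opnorm T.
Proof.
rewrite /opnorm; set S := [set _ | _ in _].
(* On a set without supremum, [sup] takes the default value 0. *)
have [[_ ub]|h] := pselect (has_sup S); last by rewrite sup_out.
apply: le_trans (ub_le_sup ub _); first exact: (norm2_ge0 (T (fun=> 0))).
exists (fun=> 0) => //; split; first exact: l2_0.
by rewrite (norm2T 0) sqnorm0 // sqrtr0.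
Qed.

Lemma norm2_le_opnorm (T : op R) (hT : is_bounded_op T) x : l2 x ->
  norm2 (T x) <= opnorm T * norm2 x.
Proof.
move=> hx; pose v := toL2 hx; have -> : T x = liftT hT v by [].
rewrite (_ : norm2 x = norm2 v) // !norm2T.
have [v0|v0] := eqVneq v 0.
  by rewrite v0 (linear_op0 (liftT_linear hT)) sqnorm0 // sqrtr0 mulr0.
have p := sqnorm_gt0 Hip v0; set q := Num.sqrt _.
have q0 : 0 < Num.sqrt (sqnorm ipT v) by rewrite sqrtr_gt0.
rewrite -ler_pdivrMr //; apply: ub_le_sup.
  have [c c0 hc] := liftT_bounded hT; exists c => _ [y [hy y1] <-].
  by rewrite (le_trans (norm2_le c0 hc hy)) // ler_piMr.
pose r := (Num.sqrt (sqnorm ipT v))^-1.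
have r0 : 0 <= r by rewrite invr_ge0 ltW.
exists (l2val (r%:C *: v)); first split; first exact: l2valP.
  rewrite norm2T sqnormZ // sqmod_real sqrtrM ?sqr_ge0 // sqrtr_sqr ger0_norm //.
  by rewrite mulVf // gt_eqF.
have -> : T (l2val (r%:C *: v)) = liftT hT (r%:C *: v) by [].
rewrite norm2T (linear_opZ (liftT_linear hT)) sqnormZ // sqmod_real sqrtrM ?sqr_ge0 //.
by rewrite sqrtr_sqr ger0_norm // mulrC.
Qed.

Lemma l2val_sum I (r : seq I) (P : pred I) (F : I -> l2T) k :
  l2val (\sum_(i <- r | P i) F i) k = \sum_(i <- r | P i) l2val (F i) k.
Proof. exact: (big_morph (fun v => l2val v k) (fun _ _ => erefl) erefl). Qed.

Lemma finite_rank_liftT (F : op R) (hF : is_bounded_op F) n :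
  rank_le F n -> finite_rank (liftT hF) n.
Proof.
move=> [v [hv h]]; exists (fun i => toL2 (hv i)) => w; have [c hc] := h w (l2valP w).
by exists c; apply/val_inj/funext => k; rewrite /= l2val_sum hc.
Qed.

Lemma is_bounded_op0 : is_bounded_op (fun _ _ => 0 : C).
Proof.
split=> [x _|a x y _ _|]; first exact: l2_0.
  by apply/funext => k; rewrite mulr0 addr0.
by exists 0 => x _; rewrite (norm2T 0) sqnorm0 // sqrtr0 mul0r.
Qed.

Lemma sing_val_set_nonempty n (A : op R) :
  [set opnorm (opsub A F) | F in [set F | is_bounded_op F /\ rank_le F n]] !=set0.
Proof.
exists (opnorm (opsub A (fun _ _ => 0))), (fun _ _ => 0) => //; split.
  exact: is_bounded_op0.
exists (fun _ _ => 0); split=> [i|x _]; first exact: l2_0.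
by exists (fun=> 0); apply/funext => k; rewrite big1 // => i _; rewrite mul0r.
Qed.

Lemma sing_val_ge0 n (A : op R) : 0 <= sing_val n A.
Proof.
apply: lb_le_inf; first exact: sing_val_set_nonempty.
by move=> _ [F _ <-]; exact: opnorm_ge0.
Qed.

Lemma sing_val_singular_numbers (A : op R) (hA : is_bounded_op A) :
  singular_numbers ipT (liftT hA) (fun n => sing_val n A).
Proof.
split.
- by move=> k; exact: sing_val_ge0.
- move=> k F c linF [v hv] c0 hF.
  (* Sequences outside [l2] are sent to the image of 0 by [insubd]; only the action on [l2] is ever
     compared. *)
  pose F' : op R := fun x => l2val (F (insubd (0 : l2T) x)).
  have F'E x (hx : l2 x) : F' x = F (toL2 hx).
    by rewrite /F'; congr (l2val (F _)); apply: val_inj; rewrite insubdK //; apply/asboolP.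
  have [d d0 hd] := liftT_bounded hA.
  have bF : is_bounded_op F'.
    split=> [x hx|a x y hx hy|]; first by rewrite F'E; exact: l2valP.
      rewrite (F'E _ (l2_linear a hx hy)) (F'E _ hx) (F'E _ hy).
      rewrite (_ : toL2 (l2_linear a hx hy) = a *: toL2 hx + toL2 hy); last exact: val_inj.
      by rewrite linF.
    (* [F] inherits boundedness from [A] and [A - F], since it is their difference. *)
    exists (Num.sqrt (2 * d ^+ 2 + 2 * c ^+ 2)) => x hx; set w := toL2 hx.
    rewrite (F'E _ hx) -/w norm2T (_ : norm2 x = norm2 w) // norm2T -sqrtrM; last first.
      by rewrite addr_ge0 // mulr_ge0 ?sqr_ge0.
    apply: ler_wsqrtr; have := hF w; have := hd w.
    set a := liftT hA w; set b := F w.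
    have := sqnorm_ge0 Hip (a + (a - b)).
    have -> : sqnorm ipT b = sqnorm ipT (a - (a - b)) by rewrite subKr.
    rewrite (sqnormD Hip a (a - b)) (sqnormD Hip a (- (a - b))) sqnormN // (ipNr Hip _ a) cReN.
    lra.
  apply: le_trans (_ : opnorm (opsub A F') <= _).
    apply: ge_inf; first by exists 0 => _ [G _ <-]; exact: opnorm_ge0.
    exists F' => //; split=> //; exists (fun i => l2val (v i)); split=> [i|x hx].
      exact: l2valP.
    have [a ha] := hv (toL2 hx); exists a; rewrite (F'E _ hx) ha; apply/funext => k'.
    by rewrite l2val_sum.
  apply: (opnorm_le c0) => x hx; set w := toL2 hx.
  have -> : opsub A F' x = l2val (liftT hA w - F w).
    by rewrite /opsub (F'E _ hx).
  have := ler_wsqrtr (hF w); rewrite sqrtrM ?sqr_ge0 // sqrtr_sqr (ger0_norm c0).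
  by rewrite -!norm2T.
move=> k e e0; have lb : has_lbound
    [set opnorm (opsub A F) | F in [set F | is_bounded_op F /\ rank_le F k]].
  by exists 0 => _ [G _ <-]; exact: opnorm_ge0.
have [_ [F [bF rF] <-] hF] := inf_adherent e0 (conj (sing_val_set_nonempty k A) lb).
exists (liftT bF); split; [exact: liftT_linear|exact: finite_rank_liftT|].
move=> w; have bAF := is_bounded_op_sub hA bF.
have := norm2_le_opnorm bAF (l2valP w).
have -> : opsub A F w = l2val (liftT hA w - liftT bF w) by [].
rewrite !norm2T => h.
have {}h : Num.sqrt (sqnorm ipT (liftT hA w - liftT bF w)) <=
    (sing_val k A + e) * Num.sqrt (sqnorm ipT w).
  by rewrite (le_trans h) // ler_wpM2r ?sqrtr_ge0 // ltW.
have me : 0 <= sing_val k A + e by rewrite addr_ge0 ?sing_val_ge0 ?ltW.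
have := lerXn2r 2 (sqrtr_ge0 _ : _ \is Num.nneg) (mulr_ge0 me (sqrtr_ge0 _) : _ \is Num.nneg) h.
by rewrite exprMn !sqr_sqrtr ?sqnorm_ge0.
Qed.

Lemma sing_sum_le (B1 B2 B3 B4 : op R) (h1 : is_bounded_op B1) (h2 : is_bounded_op B2)
    (h3 : is_bounded_op B3) (h4 : is_bounded_op B4) n :
  is_pos_op B1 -> is_pos_op B2 -> is_pos_op B3 -> is_pos_op B4 ->
  (forall v, qform ipT (liftT h1) v + qform ipT (liftT h2) v =
             qform ipT (liftT h3) v + qform ipT (liftT h4) v) ->
  \sum_(k < n) sing_val k B1 + \sum_(k < n) sing_val k B2 <=
  \sum_(k < n + n) sing_val k B3 + \sum_(k < n + n) sing_val k B4.
Proof.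
move=> p1 p2 p3 p4 hq.
exact: (singnum_sum_le Hip l2T_infdim n (liftT_positive h1 p1) (liftT_positive h2 p2)
  (liftT_positive h3 p3) (liftT_positive h4 p4) (sing_val_singular_numbers h1)
  (sing_val_singular_numbers h2) (sing_val_singular_numbers h3)
  (sing_val_singular_numbers h4) hq).
Qed.

Lemma is_pos_op0 : is_pos_op (fun _ _ => 0 : C).
Proof.
split=> [|x _]; first exact: is_bounded_op0.
have h N : inner_psum (fun=> 0) x N = 0 by rewrite /inner_psum big1 // => i _; rewrite mul0r.
by exists 0; split=> //; split; under eq_fun do rewrite h; exact: cvg_cst.
Qed.

Lemma sing_val0 n : sing_val n (fun _ _ => 0 : C) = 0.
Proof.
apply/eqP; rewrite eq_le sing_val_ge0 andbT.
apply: (singnum_le (sing_val_singular_numbers is_bounded_op0)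
  (F := liftT is_bounded_op0)) => //; first exact: liftT_linear.
  exists (fun=> 0) => v; exists (fun=> 0); rewrite big1 => [|i _]; last by rewrite scale0r.
  exact: val_inj.
by move=> v; rewrite subrr sqnorm0 // expr0n mul0r.
Qed.

Lemma L1inf0 : L1inf (fun _ _ => 0 : C).
Proof.
by split; [exact: is_bounded_op0|exists 0 => n; rewrite sing_val0 mulr0].
Qed.

End L2Space.

(** * Singular values of diagonal operators *)

Section Diagonal.
Variables (R : realType) (a : nat -> R).
Hypothesis a_ge0 : forall n, 0 <= a n.
Hypothesis a_noninc : forall m n, (m <= n)%N -> a n <= a m.
Local Notation C := R[i].
Let Hip := @l2T_inner_product R.

Lemma l2_dominated (x y : vec R) (c : R) : l2 x ->
  (forall k, sqmod (y k) <= c * sqmod (x k)) ->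
  l2 y /\ sup (range (psum2 y)) <= c * sup (range (psum2 x)).
Proof.
move=> hx h; have hN N : psum2 y N <= c * psum2 x N.
  by rewrite /psum2 mulr_sumr ler_sum // => k _.
have [c0|c0] := leP 0 c.
  have hS N : psum2 y N <= c * sup (range (psum2 x)).
    by rewrite (le_trans (hN N)) // ler_wpM2l // psum2_le_sup.
  split; first by exists (c * sup (range (psum2 x))).
  apply: ge_sup; first by exists (psum2 y 0), 0.
  by move=> _ [N _ <-].
(* A negative [c] forces both sequences to vanish. *)
have x0 k : sqmod (x k) = 0.
  apply/eqP; rewrite eq_le sqmod_ge0 andbT; have := h k; have := sqmod_ge0 (y k) => h1 h2.
  by rewrite -(nmulr_rge0 _ c0) (le_trans h1).
have y0 k : sqmod (y k) = 0.
  by apply/eqP; rewrite eq_le sqmod_ge0 andbT (le_trans (h k)) // x0 mulr0.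
have p0 z N : (forall k, sqmod (z k) = 0) -> psum2 z N = 0 :> R by move=> z0; rewrite /psum2 big1.
have s0 z : (forall k, sqmod (z k) = 0) -> sup (range (psum2 z)) = 0 :> R.
  move=> z0; rewrite (_ : range _ = [set 0]) ?sup1 //; apply/seteqP; split.
    by move=> _ [N _ <-]; rewrite p0.
  by move=> _ ->; exists 0; rewrite // p0.
split; first by exists 0 => N; rewrite p0.
by rewrite !s0 // mulr0.
Qed.

Definition diag_op : op R := fun x k => (a k)%:C * x k.

Lemma diag_op_bounded : is_bounded_op diag_op.
Proof.
have h (x : vec R) k : sqmod (diag_op x k) <= a 0 ^+ 2 * sqmod (x k).
  rewrite /diag_op sqmodM sqmod_real ler_wpM2r ?sqmod_ge0 //.
  by rewrite lerXn2r ?nnegrE // a_noninc.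
split=> [x hx|b x y _ _|]; first by have [] := l2_dominated hx (h x).
  by apply/funext => k; rewrite /diag_op; ring.
exists (a 0) => x hx; have [_ hs] := l2_dominated hx (h x).
have := ler_wsqrtr hs; rewrite sqrtrM ?sqr_ge0 // sqrtr_sqr ger0_norm //.
Qed.

Let bA := diag_op_bounded.

Lemma diag_op_pos : is_pos_op diag_op.
Proof.
split=> // x hx.
have hN N : inner_psum (diag_op x) x N = (\sum_(k < N) a k * sqmod (x k))%:C.
  rewrite rmorph_sum; apply: eq_bigr => k _ /=.
  by rewrite /diag_op -mulrA mul_conj rmorphM.
pose u N := \sum_(k < N) a k * sqmod (x k).
have nd : nondecreasing_seq u.
  by apply/nondecreasing_seqP => n; rewrite /u big_ord_recr lerDl mulr_ge0 ?sqmod_ge0.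
have ub : has_ubound (range u).
  case: (hx) => B hB; exists (a 0 * B) => _ [N _ <-].
  apply: le_trans (_ : _ <= a 0 * psum2 x N) _; last by rewrite ler_wpM2l.
  by rewrite /u /psum2 mulr_sumr ler_sum // => k _; rewrite ler_wpM2r ?sqmod_ge0 ?a_noninc.
exists (sup (range u)); split.
  apply: le_trans (ub_le_sup ub _); last by exists 0.
  by rewrite /u big_ord0.
split; under eq_fun do rewrite hN /=; first exact: nondecreasing_cvgn.
exact: cvg_cst.
Qed.

(** Upper bound: truncate to the first [n] coordinates, after which all remaining entries are at
    most [a n]. Lower bound: on the span of the first [n.+1] basis vectors the form is at least
    [a n], so [le_singnum] applies. *)
Lemma sing_val_diag n : sing_val n diag_op = a n.
Proof.
have sn := sing_val_singular_numbers bA.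
apply/eqP; rewrite eq_le; apply/andP; split.
  pose F (v : l2T R) : l2T R := \sum_(i < n) (a i)%:C *: (l2val v i *: deltaT R i).
  have FE v k : l2val (F v) k = if (k < n)%N then (a k)%:C * l2val v k else 0.
    rewrite /F l2val_sum.
    have e (i : 'I_n) : l2val ((a i)%:C *: (l2val v i *: deltaT R i)) k =
        (a i)%:C * (l2val v i * (k == i)%:R) by [].
    under eq_bigr => i _ do rewrite e.
    case: ltnP => kn; last by rewrite big1 // => i _; rewrite gtn_eqF ?mulr0 // (leq_trans _ kn).
    rewrite (bigD1 (Ordinal kn)) //= eqxx mulr1 big1 ?addr0 // => i /negPf ik.
    by rewrite (_ : (k == i) = false) ?mulr0 // eq_sym.
  apply: (singnum_le sn (F := F)) => //.
  - move=> b v w; rewrite /F scaler_sumr -big_split /=; apply: eq_bigr => i _.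
    rewrite !scalerA -scalerDl; congr (_ *: _).
    by transitivity ((a i)%:C * (b * l2val v i + l2val w i)); [by []|ring].
  - exists (fun i => deltaT R i) => v; exists (fun i => (a i)%:C * l2val v i).
    by apply: eq_bigr => i _; rewrite scalerA.
  move=> v; rewrite !sqnormT.
  have [|_ //] := @l2_dominated v (l2val (liftT bA v - F v)) (a n ^+ 2) (l2valP v).
  move=> k; have -> : l2val (liftT bA v - F v) k = (a k)%:C * l2val v k - l2val (F v) k by [].
  rewrite FE; case: ltnP => kn; first by rewrite subrr sqmod0 mulr_ge0 ?sqr_ge0 ?sqmod_ge0.
  by rewrite subr0 sqmodM sqmod_real ler_wpM2r ?sqmod_ge0 // lerXn2r ?nnegrE // a_noninc.
apply: (le_singnum Hip sn (@orthonormal_deltaT R n.+1)) => c x xE.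
have cx i : (i < n.+1)%N -> l2val x i = c i.
  move=> iN; rewrite -ipT_delta xE; exact: (ip_combination Hip c (@orthonormal_deltaT R n.+1)).
rewrite {1}xE (sqnorm_combination Hip c (@orthonormal_deltaT R n.+1)) mulr_sumr.
rewrite /qform {2}xE ip_sumr // cRe_sum ler_sum // => i _.
rewrite ipZr // ipT_delta (_ : l2val (liftT bA x) i = (a i)%:C * l2val x i) // cx //.
rewrite [conjc _ * _]mulrC -mulrA mul_conj cReM /= mul0r subr0 ler_wpM2r ?sqmod_ge0 // a_noninc //.
by rewrite -ltnS.
Qed.

End Diagonal.

(** * Additivity of Dixmier traces *)

Section StepFunctions.
Variable R : realType.
Local Notation leb := (@lebesgue_measure R).

Lemma absz_floor_itv (t : R) n : (n%:R <= t < n.+1%:R) -> `|Num.floor t|%N = n.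
Proof.
move=> /andP[h1 h2]; suff -> : Num.floor t = n by [].
by apply: floor_def; rewrite -natr1 in h2; rewrite intrD -pmulrn h1.
Qed.

Lemma absz_floor_bounds (t : R) : 0 <= t ->
  `|Num.floor t|%N%:R <= t < `|Num.floor t|%N.+1%:R.
Proof.
move=> t0; have := floor_itv t; rewrite intrD.
have f0 : 0 <= Num.floor t by rewrite floor_ge0.
by rewrite -natr1 natr_absz ger0_norm.
Qed.

Lemma bigcup_itv_nat : \bigcup_n `[n%:R : R, n.+1%:R[%classic = `[0, +oo[%classic.
Proof.
apply/seteqP; split=> t /=.
  move=> [n _ /=]; rewrite !in_itv /= andbT => /andP[h _].
  by rewrite (le_trans _ h) ?ler0n.
rewrite in_itv /= andbT => t0; exists `|Num.floor t|%N => //=.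
by rewrite in_itv /= absz_floor_bounds.
Qed.

Lemma measurable_step (m : nat -> R) :
  measurable_fun (`[0, +oo[%classic : set R) (fun t => m `|Num.floor t|%N).
Proof.
rewrite -bigcup_itv_nat; apply/measurable_fun_bigcup => // n.
apply: (@eq_measurable_fun _ _ _ _ _ (cst (m n))) => // t.
by rewrite inE /= in_itv /= => /absz_floor_itv ->.
Qed.

Variables (m : nat -> R) (c : R).
Hypothesis m_ge0 : forall n, 0 <= m n.
Hypothesis m_le : forall n, n.+1%:R * m n <= c.
Let f (t : R) := m `|Num.floor t|%N.

Lemma m_bound n : m n <= c.
Proof. by rewrite (le_trans _ (m_le n)) // ler_peMl // ler1n. Qed.

Lemma integrable_step (t : R) : leb.-integrable `[0, t]%classic (EFin \o f).
Proof.
apply: measurable_bounded_integrable => //.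
- rewrite /= lebesgue_measure_itv /=; case: ifP => _; rewrite ?ltry //.
- apply: measurable_funS (measurable_step m) => // s /=; rewrite !in_itv /= andbT.
  by case/andP.
exists c; split; first exact: num_real.
move=> M cM s _ /=; rewrite /f ger0_norm //; exact: le_trans (m_bound _) (ltW cM).
Qed.

Lemma step_integral_add n (t : R) : n%:R <= t <= n.+1%:R ->
  \int[leb]_(s in `[0, t]) f s = \int[leb]_(s in `[0, n%:R]) f s + (t - n%:R) * m n.
Proof.
move=> /andP[h1 h2]; have n0 : (0 : R) <= n%:R by rewrite ler0n.
apply/eqP; rewrite addrC -subr_eq; apply/eqP.
rewrite Rintegral_itvB; [|exact: integrable_step|by rewrite bnd_simp|by rewrite bnd_simp].
(* Dropping the endpoint [t] matters when [t = n.+1], where the step function jumps. *)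
rewrite -Rintegral_itv_bndo_bndc; last first.
  apply: integrableS (integrable_step t) => // s /=; rewrite !in_itv /= => /andP[a b].
  by rewrite (le_trans n0 (ltW a)) ltW.
rewrite (@eq_Rintegral _ _ _ _ _ (cst (m n))); last first.
  move=> s; rewrite inE /= in_itv /= => /andP[a b]; rewrite /f (@absz_floor_itv s n) //.
  by rewrite ltW //= (lt_le_trans b).
rewrite Rintegral_cst //= lebesgue_measure_itv /= lte_fin; case: ltP => [_|tn] /=.
  by rewrite mulrC.
have -> : t = n%:R by apply/eqP; rewrite eq_le tn h1.
by rewrite subrr mul0r mulr0.
Qed.

Lemma step_integral_nat n : \int[leb]_(s in `[0, n%:R]) f s = \sum_(k < n) m k.
Proof.
elim: n => [|n IH].
  by rewrite big_ord0 set_itv1 Rintegral_set1.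
rewrite (@step_integral_add n) ?lexx ?ler_nat ?leqnSn // IH big_ord_recr /=.
have -> : n.+1%:R - n%:R = 1 :> R by rewrite -natr1 [n%:R + 1]addrC addrK.
by rewrite mul1r.
Qed.

Lemma step_integral (t : R) : 0 <= t -> \int[leb]_(s in `[0, t]) f s =
  \sum_(k < `|Num.floor t|%N) m k + (t - `|Num.floor t|%N%:R) * m `|Num.floor t|%N.
Proof.
move=> t0; have /andP[h1 h2] := absz_floor_bounds t0.
by rewrite (@step_integral_add `|Num.floor t|%N) ?h1 ?ltW // step_integral_nat.
Qed.

Lemma ln1D_ge (x : R) : 0 <= x -> x <= 1 -> x / 2 <= ln (1 + x).
Proof.
move=> x0 x1; have p : 0 < 1 + x by lra.
have h : ln ((1 + x)^-1) <= (1 + x)^-1 - 1.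
  have := @le_ln1Dx R ((1 + x)^-1 - 1); rewrite [1 + (_ - _)]addrC subrK; apply.
  by rewrite ltrBrDr addNr invr_gt0.
rewrite lnV ?posrE // in h.
have : x / 2 <= 1 - (1 + x)^-1.
  have -> : 1 - (1 + x)^-1 = x / (1 + x) by field; rewrite gt_eqF.
  by rewrite ler_wpM2l // lef_pV2 ?posrE //; lra.
lra.
Qed.

(** With x = (t - n) / (1 + n) in [0, 1], the left side is at most x c, while the logarithm grows by
    ln (1 + x) >= x / 2. *)
Lemma step_increment_le n (t : R) : n%:R <= t <= n.+1%:R ->
  (t - n%:R) * m n <= 2 * c * (ln (1 + t) - ln (1 + n%:R)).
Proof.
move=> /andP[h1 h2]; have n0 : (0 : R) <= n%:R by rewrite ler0n.
have n1 : (0 : R) < 1 + n%:R by lra.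
rewrite -natr1 in h2.
pose x := (t - n%:R) / (1 + n%:R).
have x0 : 0 <= x by rewrite divr_ge0 ?subr_ge0 // ltW.
have x1 : x <= 1 by rewrite ler_pdivrMr // mul1r; lra.
have c0 : 0 <= c by rewrite (le_trans _ (m_bound 0)).
have e : ln (1 + t) - ln (1 + n%:R) = ln (1 + x).
  have -> : 1 + t = (1 + n%:R) * (1 + x).
    by rewrite mulrDr mulr1 /x mulrCA divff ?gt_eqF // mulr1; ring.
  by rewrite lnM ?posrE //; [rewrite addrC addKr|lra].
rewrite e; apply: le_trans (_ : _ <= 2 * c * (x / 2)) _; last first.
  by rewrite ler_wpM2l ?ln1D_ge // mulr_ge0.
have -> : 2 * c * (x / 2) = x * c by field.
apply: le_trans (_ : _ <= x * (n.+1%:R * m n)) _; last by rewrite ler_wpM2l.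
rewrite /x mulrA -natr1 [n%:R + 1]addrC mulfVK ?gt_eqF //.
Qed.

Lemma step_integral_le (t : R) : 0 <= t -> \int[leb]_(s in `[0, t]) f s <= 2 * c * ln (1 + t).
Proof.
move=> t0; rewrite step_integral //; set n := `|Num.floor t|%N.
have hn k : \sum_(i < k) m i <= 2 * c * ln (1 + k%:R).
  elim: k => [|k IH]; first by rewrite big_ord0 addr0 ln1 mulr0.
  have := @step_increment_le k k.+1%:R; rewrite lexx ler_nat leqnSn => /(_ isT).
  have -> : k.+1%:R - k%:R = 1 :> R by rewrite -natr1 [k%:R + 1]addrC addrK.
  by rewrite mul1r big_ord_recr /=; move: IH; lra.
have /andP[h1 h2] := absz_floor_bounds t0.
have := @step_increment_le n t; rewrite h1 (ltW h2) => /(_ isT); have := hn n; lra.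
Qed.

(** Each of the [n] extra terms is at most [c / n.+1]. *)
Lemma sum_double_le n : \sum_(k < n + n) m k <= \sum_(k < n) m k + c.
Proof.
rewrite big_split_ord /= lerD2l.
have c0 : 0 <= c by rewrite (le_trans _ (m_bound 0)).
apply: le_trans (_ : _ <= \sum_(i < n) (c / n.+1%:R)) _.
  apply: ler_sum => i _; rewrite ler_pdivlMr ?ltr0n // mulrC.
  rewrite (le_trans _ (m_le (n + i))) // ler_wpM2r // ler_nat ltnS leq_addr //.
rewrite sum_const_ord mulrCA ler_piMr //.
by rewrite ler_pdivrMr ?ltr0n // mul1r ler_nat leqnSn.
Qed.

End StepFunctions.

(** * Extended limits of Dixmier functions *)

Section ExtendedLimits.
Variable R : realType.
Local Notation leb := (@lebesgue_measure R).
Implicit Types (x y : R -> R) (om : (R -> R) -> R).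

Lemma pos_halfE (t : R) : pos_half t = (0 < t) :> Prop.
Proof. by rewrite /pos_half /= in_itv /= andbT. Qed.

Lemma measurable_pos_half : measurable (@pos_half R).
Proof. exact: measurable_itv. Qed.

Lemma ae_leb_filter : Filter (almost_everywhere leb).
Proof.
exact: (ae_filter_ringOfSetsType (leb : {measure set (measurableTypeR R) -> \bar R})).
Qed.

Lemma Linf_bounded x (c : R) : measurable_fun (@pos_half R) x ->
  (forall t, 0 < t -> `|x t| <= c) -> Linf x.
Proof. by move=> mx hx; split=> //; exists c; apply: aeW => t; rewrite pos_halfE; exact: hx. Qed.

Lemma LinfD x y : Linf x -> Linf y -> Linf (fun t => x t + y t).
Proof.
move=> [mx [c hc]] [my [d hd]]; split; first exact: measurable_funD.
exists (c + d); apply: (@filterS2 _ _ ae_leb_filter _ _ _ _ hc hd) => t h1 h2 t0.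
by rewrite (le_trans (ler_normD _ _)) // lerD ?h1 ?h2.
Qed.

Lemma LinfZ (k : R) x : Linf x -> Linf (fun t => k * x t).
Proof.
move=> [mx [c hc]]; split; first by apply: measurable_funM => //; exact: measurable_cst.
exists (`|k| * c); apply: (@filterS _ _ ae_leb_filter _ _ _ hc) => t h t0.
by rewrite normrM ler_wpM2l // h.
Qed.

Lemma Linf_cst (k : R) : Linf (fun=> k : R).
Proof. by apply: (@Linf_bounded _ `|k|) => //; exact: measurable_cst. Qed.

Lemma measurable_inv_ln1D : measurable_fun (@pos_half R) (fun t => (ln (1 + t))^-1).
Proof.
apply: open_continuous_measurable_fun; first exact: interval_open.
move=> t; rewrite inE pos_halfE => t0; have l0 : 0 < ln (1 + t) by rewrite ln_gt0 // ltrDl.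
apply: cvgV; first by rewrite gt_eqF.
apply: continuous_comp; last by apply: continuous_ln; lra.
by apply: cvgD; [exact: cvg_cst|exact: cvg_id].
Qed.

Lemma measurable_absz_floor (m : nat -> R) :
  measurable_fun (@pos_half R) (fun t => m `|Num.floor t|%N).
Proof.
apply: measurable_funS (measurable_step m) => // t.
by rewrite pos_halfE /= in_itv /= andbT; exact: ltW.
Qed.

Section Om.
Variable om : (R -> R) -> R.
Hypothesis hom : ext_limit om.

Lemma om_cst (k : R) : om (fun=> k) = k.
Proof. by case: hom => _ _ _; apply; [exact: Linf_cst|exact: cvg_cst]. Qed.

Lemma om_add x y : Linf x -> Linf y -> om (fun t => x t + y t) = om x + om y.
Proof. by case: hom => h _ _ _; exact: h. Qed.

Lemma om_scale (k : R) x : Linf x -> om (fun t => k * x t) = k * om x.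
Proof. by case: hom => _ h _ _; exact: h. Qed.

Lemma om_small x (C : R) : Linf x -> (forall t, 0 < t -> `|x t| <= C * (ln (1 + t))^-1) ->
  om x = 0.
Proof.
move=> hx h; case: hom => _ _ _; apply=> //.
apply/cvgrPdist_le => e e0; near=> t.
have t0 : 0 < t by near: t; apply: nbhs_pinfty_gt; exact: num_real.
have t1 : expR (`|C| / e) < t by near: t; apply: nbhs_pinfty_gt; exact: num_real.
have l0 : 0 < ln (1 + t) by rewrite ln_gt0 // ltrDl.
have l1 : `|C| / e <= ln (1 + t).
  rewrite -[leLHS]expRK ler_ln ?posrE ?expR_gt0 //; lra.
rewrite sub0r normrN (le_trans (h t t0)) // ler_pdivrMr //.
by rewrite (le_trans (ler_norm C)) // mulrC -ler_pdivrMr.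
Unshelve. all: by end_near. Qed.

(** Errors of order 1 / ln t are invisible to [om]. The case [C = 0] identifies functions that agree
    on the half-line but may differ elsewhere. *)
Lemma om_eq_small x y (C : R) : Linf x -> Linf y ->
  (forall t, 0 < t -> `|x t - y t| <= C * (ln (1 + t))^-1) -> om x = om y.
Proof.
move=> hx hy h; have hy' := LinfZ (-1) hy.
have := @om_small (fun t => x t + -1 * y t) C (LinfD hx hy').
rewrite om_add // om_scale // mulN1r => e.
apply/eqP; rewrite -subr_eq0 e // => t t0.
by rewrite mulN1r h.
Qed.

End Om.

Lemma dixmier_funE (B : op R) t : 0 < t -> L1inf B -> dixmier_fun B t =
  (ln (1 + t))^-1 * (\sum_(k < `|Num.floor t|%N) sing_val k B +
    (t - `|Num.floor t|%N%:R) * sing_val `|Num.floor t|%N B).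
Proof.
move=> t0 [_ [c hc]]; rewrite /dixmier_fun.
by rewrite (step_integral (fun n => sing_val_ge0 n B) hc (ltW t0)).
Qed.

Lemma dixmier_fun_Linf (B : op R) : L1inf B -> Linf (dixmier_fun B).
Proof.
move=> hB; have [_ [c hc]] := hB; apply: (@Linf_bounded _ (2 * c)) => [|t t0].
  apply: (@eq_measurable_fun _ _ _ _ (@pos_half R) (fun t : R =>
    (ln (1 + t))^-1 * (\sum_(k < `|Num.floor t|%N) sing_val k B +
    (t - `|Num.floor t|%N%:R) * sing_val `|Num.floor t|%N B))).
    by move=> t; rewrite inE pos_halfE => t0; rewrite dixmier_funE.
  apply: measurable_funM; first exact: measurable_inv_ln1D.
  apply: measurable_funD; first exact: (measurable_absz_floor (fun n => \sum_(k < n) sing_val k B)).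
  apply: measurable_funM; last exact: (measurable_absz_floor (fun n => sing_val n B)).
  apply: measurable_funB; last exact: (measurable_absz_floor (fun n => n%:R)).
  exact: measurable_id.
have l0 : 0 < ln (1 + t) by rewrite ln_gt0 // ltrDl.
have I0 : 0 <= \int[leb]_(s in `[0, t]) sing_fun B s.
  by apply: Rintegral_ge0 => s _; exact: sing_val_ge0.
rewrite /dixmier_fun ger0_norm ?mulr_ge0 ?invr_ge0 ?(ltW l0) //.
rewrite mulrC ler_pdivrMr //.
exact: (step_integral_le (fun n => sing_val_ge0 n B) hc (ltW t0)).
Qed.

(** Here [S] and [T] stand for sums of the first n and 2 n singular values of the four operators,
    and [r] for the contribution of the incomplete unit interval to the integral. *)
Lemma additivity_error (c1 c2 c3 c4 S1 S2 S3 S4 T1 T2 T3 T4 r1 r2 r3 r4 : R) :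
  S1 + S2 <= T3 + T4 -> S3 + S4 <= T1 + T2 ->
  T1 <= S1 + c1 -> T2 <= S2 + c2 -> T3 <= S3 + c3 -> T4 <= S4 + c4 ->
  0 <= r1 <= c1 -> 0 <= r2 <= c2 -> 0 <= r3 <= c3 -> 0 <= r4 <= c4 ->
  `|S1 + r1 + (S2 + r2) - (S3 + r3 + (S4 + r4))| <= 2 * (c1 + c2 + c3 + c4).
Proof.
move=> s1 s2 d1 d2 d3 d4 /andP[? ?] /andP[? ?] /andP[? ?] /andP[? ?].
rewrite ler_norml; apply/andP; split; lra.
Qed.

(** [sing_sum_le], used in both directions, shows that the two sides differ by a bounded amount
    before the division by ln (1 + t). Equality of quadratic forms is how the operator identity
    enters. *)
Lemma dixmier_additive om (B1 B2 B3 B4 : op R) (h1 : is_bounded_op B1)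
    (h2 : is_bounded_op B2) (h3 : is_bounded_op B3) (h4 : is_bounded_op B4) :
  ext_limit om -> pos_L1inf B1 -> pos_L1inf B2 -> pos_L1inf B3 -> pos_L1inf B4 ->
  (forall v, qform (@ipT R) (liftT h1) v + qform (@ipT R) (liftT h2) v =
             qform (@ipT R) (liftT h3) v + qform (@ipT R) (liftT h4) v) ->
  dixmier_trace_pos om B1 + dixmier_trace_pos om B2 =
  dixmier_trace_pos om B3 + dixmier_trace_pos om B4.
Proof.
move=> hom [p1 l1] [p2 l2] [p3 l3] [p4 l4] hq; rewrite /dixmier_trace_pos.
have [D1 D2] := (dixmier_fun_Linf l1, dixmier_fun_Linf l2).
have [D3 D4] := (dixmier_fun_Linf l3, dixmier_fun_Linf l4).
have [_ [c1 hc1]] := l1; have [_ [c2 hc2]] := l2.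
have [_ [c3 hc3]] := l3; have [_ [c4 hc4]] := l4.
apply: (etrans (esym (om_add hom D1 D2))); apply: (etrans _ (om_add hom D3 D4)).
apply: (@om_eq_small _ hom _ _ (2 * (c1 + c2 + c3 + c4)) (LinfD D1 D2) (LinfD D3 D4)).
move=> t t0; have lt0 : 0 < ln (1 + t) by rewrite ln_gt0 // ltrDl.
rewrite !dixmier_funE // -!mulrDr -mulrBr normrM mulrC.
rewrite [`|_^-1|]ger0_norm ?invr_ge0 ?(ltW lt0) // ler_wpM2r ?invr_ge0 ?(ltW lt0) //.
have /andP[b1 b2] := absz_floor_bounds (ltW t0); set n := `|Num.floor t|%N in b1 b2 *.
have r (B : op R) c : (forall n, n.+1%:R * sing_val n B <= c) ->
    0 <= (t - n%:R) * sing_val n B <= c.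
  move=> hc; rewrite mulr_ge0 ?subr_ge0 ?sing_val_ge0 //=.
  rewrite (le_trans _ (hc n)) // ler_wpM2r ?sing_val_ge0 //.
  have : (0 : R) <= n%:R by rewrite ler0n.
  by rewrite -natr1 in b2 *; lra.
have s1 := sing_sum_le n p1 p2 p3 p4 hq.
have s2 := sing_sum_le n p3 p4 p1 p2 (fun v => esym (hq v)).
have d1 := sum_double_le (fun k => sing_val_ge0 k B1) hc1 n.
have d2 := sum_double_le (fun k => sing_val_ge0 k B2) hc2 n.
have d3 := sum_double_le (fun k => sing_val_ge0 k B3) hc3 n.
have d4 := sum_double_le (fun k => sing_val_ge0 k B4) hc4 n.
exact: additivity_error s1 s2 d1 d2 d3 d4 (r _ _ hc1) (r _ _ hc2) (r _ _ hc3) (r _ _ hc4).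
Qed.

End ExtendedLimits.

(** * The oscillating sequence *)

Section LogLogOscillation.
Variable R : realType.
Local Notation e := (expR 1 : R).
Implicit Types (K al be s t : R).

Definition loglog K al be t : R := K + al * cos (ln (ln t)) + be * sin (ln (ln t)).

(** The family [loglog] is stable under g -> g + g', which acts on the coefficients by a rotation
    composed with a scaling. Its inverse is the action of [Mop]. *)
Lemma is_derive_ln_loglog K al be t : 1 < t ->
  is_derive t 1 (fun t => ln t * loglog K al be t) (loglog K (al + be) (be - al) t / t).
Proof.
move=> t1; have l0 : 0 < ln t by rewrite ln_gt0.
have t0 : 0 < t by lra.
have d1 := is_derive1_ln t0.
have d2 : is_derive t 1 (fun t => ln (ln t)) ((ln t)^-1 * t^-1).
  by apply: is_derive1_comp; exact: is_derive1_ln.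
have d3 : is_derive t 1 (fun t => cos (ln (ln t))) (- sin (ln (ln t)) * ((ln t)^-1 * t^-1)).
  exact: is_derive1_comp.
have d4 : is_derive t 1 (fun t => sin (ln (ln t))) (cos (ln (ln t)) * ((ln t)^-1 * t^-1)).
  exact: is_derive1_comp.
apply: is_derive_eq; rewrite /loglog /GRing.scale /=; field.
by rewrite !gt_eqF.
Qed.

Lemma e_gt1 : 1 < e. Proof. by rewrite expR_gt1. Qed.

Lemma ln_ge1 t : e <= t -> 1 <= ln t.
Proof.
by move=> et; rewrite -[leLHS]expRK ler_ln ?posrE ?expR_gt0 // (lt_le_trans _ et) ?expR_gt0.
Qed.

Lemma mvt_ln_loglog K al be s t : e <= s -> s < t -> exists2 c, s < c < t &
  ln t * loglog K al be t - ln s * loglog K al be s =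
  loglog K (al + be) (be - al) c / c * (t - s).
Proof.
move=> es st; have e1 := e_gt1.
have hd x : s <= x -> is_derive x 1 (fun t => ln t * loglog K al be t)
    (loglog K (al + be) (be - al) x / x).
  by move=> sx; apply: is_derive_ln_loglog; lra.
have [|//|c] := MVT st (f := fun t => ln t * loglog K al be t)
   (df := fun x => loglog K (al + be) (be - al) x / x).
- by move=> x; rewrite in_itv /= => /andP[/ltW sx _]; exact: hd.
- apply: derivable_within_continuous => x; rewrite in_itv /= => /andP[sx _].
  by case: (hd x sx).
by rewrite in_itv /= => h1 h2; exists c.
Qed.

(** The derivative of [log_mass]: the coefficients (4, 1, 0) become (4, 1, -1). *)
Definition trace_density t := loglog 4 1 (-1) t / t.

Lemma loglog_bounds t : 2 <= loglog 4 1 (-1) t <= 6.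
Proof.
rewrite /loglog; have := cos_geN1 (ln (ln t)); have := cos_le1 (ln (ln t)).
have := sin_geN1 (ln (ln t)); have := sin_le1 (ln (ln t)).
move=> *; apply/andP; split; lra.
Qed.

(** For s >= e the increment of ln ln is at most t / s - 1, and cos - sin is 2-Lipschitz. So the
    numerator grows by at most 2 (t / s - 1), which its lower bound 2 absorbs after multiplication
    by t / s. *)
Lemma trace_density_noninc s t : e <= s -> s <= t -> trace_density t <= trace_density s.
Proof.
move=> es; rewrite le_eqVlt => /predU1P[->//|st]; have e1 := e_gt1.
have [s0 t0] : 0 < s /\ 0 < t by split; lra.
have ls := ln_ge1 es; have lt : ln s < ln t by rewrite ltr_ln ?posrE.
have hln x : 0 < x -> ln x <= x - 1 :> R.
  move=> x0; have := @le_ln1Dx R (x - 1); rewrite [1 + (_ - _)]addrC subrK; apply; lra.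
have h1 : ln (ln t) - ln (ln s) <= t / s - 1.
  rewrite -ln_div ?posrE; try lra.
  apply: le_trans (hln _ _) _; first by rewrite divr_gt0; lra.
  apply: le_trans (_ : _ <= ln t - ln s) _.
    have -> : ln t / ln s - 1 = (ln t - ln s) / ln s by field; rewrite gt_eqF //; lra.
    by rewrite ler_pdivrMr ?ler_peMr //; lra.
  by rewrite -ln_div ?posrE // hln // divr_gt0.
pose phi w := cos w - sin w : R.
have [c _c hc] : exists2 c, c \in `]ln (ln s), ln (ln t)[%R &
    phi (ln (ln t)) - phi (ln (ln s)) = (- sin c - cos c) * (ln (ln t) - ln (ln s)).
  apply: (@MVT R phi (fun c => - sin c - cos c)); first by rewrite ltr_ln ?posrE; lra.
  by apply: derivable_within_continuous => x xin; apply: derivableB; apply: ex_derive.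
have L0 : 0 <= ln (ln t) - ln (ln s) by rewrite subr_ge0 ler_ln ?posrE; lra.
have h2 : phi (ln (ln t)) - phi (ln (ln s)) <= 2 * (t / s - 1).
  rewrite hc; apply: le_trans (_ : _ <= 2 * (ln (ln t) - ln (ln s))) _; last by lra.
  rewrite ler_wpM2r //; have := cos_geN1 c; have := sin_geN1 c; lra.
have ts : 0 <= t / s - 1 by rewrite subr_ge0 ler_pdivlMr // mul1r ltW.
rewrite /trace_density; have /andP[b1 _] := loglog_bounds s.
rewrite ler_pdivrMr // -mulrA [s^-1 * t]mulrC.
have h3 : 2 * (t / s - 1) <= loglog 4 1 (-1) s * (t / s - 1) by rewrite ler_wpM2r.
have h4 : loglog 4 1 (-1) t - loglog 4 1 (-1) s = phi (ln (ln t)) - phi (ln (ln s)).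
  by rewrite /loglog /phi; ring.
move: h2; rewrite -h4; lra.
Qed.

Lemma trace_density_bounds t : 0 < t -> 0 <= trace_density t <= 6 / t.
Proof.
move=> t0; have /andP[h1 h2] := loglog_bounds t.
by rewrite divr_ge0 ?ler_pM2r ?invr_gt0 ?(ltW t0) //; lra.
Qed.

Definition log_mass t := ln t * loglog 4 1 0 t.

Lemma mvt_log_mass s t : e <= s -> s < t ->
  exists2 c, s < c < t & log_mass t - log_mass s = trace_density c * (t - s).
Proof.
move=> es st; have [c hc h] := mvt_ln_loglog 4 1 0 es st; exists c => //.
by rewrite /log_mass h /trace_density addr0 sub0r.
Qed.

Lemma log_mass_lipschitz s t : e <= s -> e <= t ->
  `|log_mass t - log_mass s| <= 6 * `|t - s|.
Proof.
have e1 := e_gt1.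
wlog st : s t / s < t => [H|] es et.
  have [st|ts|->] := ltgtP s t; [exact: H| |by rewrite !subrr normr0 mulr0].
  by rewrite distrC [X in _ <= _ * X]distrC; exact: H.
have [c /andP[sc ct] ->] := mvt_log_mass es st.
have c0 : 0 < c by lra.
have /andP[h1 h2] := trace_density_bounds c0.
rewrite normrM ler_wpM2r // ger0_norm // (le_trans h2) //.
rewrite ler_pdivrMr //; lra.
Qed.

(** The shift by [e] keeps all arguments in the range where [trace_density] is nonincreasing. *)
Definition osc_seq n : R := log_mass (e + n.+1%:R) - log_mass (e + n%:R).

Lemma osc_seq_mvt n : exists2 c, e + n%:R < c < e + n.+1%:R & osc_seq n = trace_density c.
Proof.
have n0 : (0 : R) <= n%:R by rewrite ler0n.
have [||c hc] := @mvt_log_mass (e + n%:R) (e + n.+1%:R); first by rewrite lerDl.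
  by rewrite ltrD2l ltr_nat.
have -> : e + n.+1%:R - (e + n%:R) = 1 :> R by rewrite -natr1; ring.
rewrite mulr1 => h.
by exists c.
Qed.

Lemma osc_seq_ge0 n : 0 <= osc_seq n.
Proof.
have n0 : (0 : R) <= n%:R by rewrite ler0n.
have [c /andP[h _] ->] := osc_seq_mvt n; have e1 := e_gt1.
have c0 : 0 < c by lra.
by have /andP[] := trace_density_bounds c0.
Qed.

Lemma osc_seq_le n : n.+1%:R * osc_seq n <= 6.
Proof.
have n0 : (0 : R) <= n%:R by rewrite ler0n.
have [c /andP[h _] ->] := osc_seq_mvt n; have e1 := e_gt1.
have c0 : 0 < c by lra.
have /andP[_ hc] := trace_density_bounds c0.
apply: le_trans (_ : _ <= n.+1%:R * (6 / c)) _; first by rewrite ler_wpM2l.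
rewrite mulrA ler_pdivrMr // -natr1; lra.
Qed.

Lemma osc_seq_noninc m n : (m <= n)%N -> osc_seq n <= osc_seq m.
Proof.
rewrite leq_eqVlt => /predU1P[->//|mn].
have m0 : (0 : R) <= m%:R by rewrite ler0n.
have [c /andP[h1 _] ->] := osc_seq_mvt n; have [d /andP[h2 h3] ->] := osc_seq_mvt m.
have mn' : (m.+1%:R : R) <= n%:R by rewrite ler_nat.
apply: trace_density_noninc; lra.
Qed.

Lemma osc_seq_sum n : \sum_(k < n) osc_seq k = log_mass (e + n%:R) - log_mass e.
Proof.
elim: n => [|n IH]; first by rewrite big_ord0 addr0 subrr.
by rewrite big_ord_recr /= IH /osc_seq; ring.
Qed.

(** Cut off below [e], so that the integral in [Mop] effectively starts at [e], where ln ln vanishes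
    and the primitive equals [al], and avoids the oscillations of ln ln near 1. *)
Definition osc al be t : R := if e <= t then al * cos (ln (ln t)) + be * sin (ln (ln t)) else 0.

Lemma osc_step_integral_near : exists C : R, forall t, 0 < t ->
  `|(\sum_(k < `|Num.floor t|%N) osc_seq k + (t - `|Num.floor t|%N%:R) * osc_seq `|Num.floor t|%N)
    - ln (1 + t) * (4 + osc 1 0 t)| <= C.
Proof.
(* For [t >= e] the first four terms bound, in order, the incomplete interval, the start of the
   telescoping sum, the passage from [e + n] to [t], and that from ln (1 + t) to ln t. The last one
   covers 4 ln (1 + t) when [t < e]. *)
exists (6 + `|log_mass e| + 6 * (e + 1) + 5 + 16 * (e + 2)) => t t0.
have e1 := e_gt1.
have /andP[b1 b2] := absz_floor_bounds (ltW t0); set n := `|Num.floor t|%N in b1 b2 *.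
have n0 : (0 : R) <= n%:R by rewrite ler0n.
have r0 := osc_seq_ge0 n; have rn := osc_seq_le n.
have r1 : osc_seq n <= 6 by rewrite (le_trans _ rn) // ler_peMl // ler1n.
rewrite -natr1 in b2.
have r2 : 0 <= (t - n%:R) * osc_seq n <= 6.
  apply/andP; split; first by apply: mulr_ge0 => //; lra.
  by apply: le_trans r1; rewrite ler_piMl //; lra.
case/andP: r2 => r2 r3.
have l0 : 0 < ln (1 + t) by rewrite ln_gt0 // ltrDl.
have l1 : ln (1 + t) <= t by apply: le_ln1Dx; lra.
have Le := ler_norm (log_mass e); have Le' := ler_norm (- log_mass e); rewrite normrN in Le'.
rewrite /osc; case: (leP e t) => et.
  rewrite osc_seq_sum.
  have h1 : `|log_mass (e + n%:R) - log_mass t| <= 6 * (e + 1).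
    apply: le_trans (log_mass_lipschitz et _) _; first by lra.
    by rewrite ler_wpM2l // ler_norml; apply/andP; split; lra.
  have lt0 : 0 < ln t by rewrite ln_gt0 //; lra.
  have d0 : 0 <= ln (1 + t) - ln t by rewrite subr_ge0 ler_ln ?posrE; lra.
  have d1 : ln (1 + t) - ln t <= 1.
    have := @le_ln1Dx R (t^-1); have ti : 0 < t^-1 by rewrite invr_gt0.
    have t1 : t^-1 <= 1 by rewrite invf_le1 //; lra.
    have -> : ln (1 + t^-1) = ln (1 + t) - ln t.
      by rewrite -ln_div ?posrE; [congr ln; field; rewrite gt_eqF|lra..].
    move=> h; have := h; lra.
  have hc : 3 <= 4 + (1 * cos (ln (ln t)) + 0 * sin (ln (ln t))) <= 5.
    have := cos_geN1 (ln (ln t)); have := cos_le1 (ln (ln t)); lra.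
  set k := 4 + _ in hc *; case/andP: hc => k1 k2.
  have mE : log_mass t = ln t * k by rewrite /log_mass /loglog /k addrA.
  have h2 : 0 <= (ln (1 + t) - ln t) * k <= 5.
    rewrite mulr_ge0 //=; last by lra.
    apply: le_trans (_ : _ <= 1 * 5) _; last by rewrite mul1r.
    by rewrite ler_pM //; lra.
  case/andP: h2 => h2 h3; rewrite mE in h1; move: h1; rewrite ler_norml => /andP[h1 h4].
  rewrite ler_norml; apply/andP; split; lra.
rewrite addr0.
have hs : 0 <= \sum_(k < n) osc_seq k <= 6 * (e + 1).
  rewrite sumr_ge0 => [|i _]; last exact: osc_seq_ge0.
  apply: le_trans (_ : \sum_(k < n) 6 <= _).
    by apply: ler_sum => i _; rewrite (le_trans _ (osc_seq_le i)) // ler_peMl ?osc_seq_ge0 // ler1n.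
  by rewrite sum_const_ord mulrC ler_wpM2l //; lra.
case/andP: hs => hs1 hs2.
have Ln := normr_ge0 (log_mass e).
rewrite ler_norml; apply/andP; split; lra.
Qed.

End LogLogOscillation.

(** * The logarithmic mean of oscillating functions *)

Section MopOscillation.
Variable R : realType.
Local Notation e := (expR 1 : R).
Local Notation leb := (@lebesgue_measure R).
Implicit Types (K al be s t : R) (om : (R -> R) -> R).

Lemma continuous_loglog K al be x : 1 < x -> {for x, continuous (loglog K al be)}.
Proof.
move=> x1; have l0 : 0 < ln x by rewrite ln_gt0.
have x0 : 0 < x by lra.
have c1 : {for x, continuous (fun s => ln (ln s))}.
  by apply: continuous_comp; exact: continuous_ln.
have c2 : {for x, continuous (fun s => cos (ln (ln s)))}.
  by apply: continuous_comp c1 _; exact: continuous_cos.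
have c3 : {for x, continuous (fun s => sin (ln (ln s)))}.
  by apply: continuous_comp c1 _; exact: continuous_sin.
apply: cvgD; [apply: cvgD; first exact: cvg_cst|]; exact: cvgMl_tmp.
Qed.

Lemma loglog_integral al be t : e <= t ->
  \int[leb]_(s in `[e, t]) (loglog 0 (al + be) (be - al) s / s) =
  ln t * loglog 0 al be t - al.
Proof.
have e1 := @e_gt1 R; pose F t := ln t * loglog 0 al be t.
have Fe : F e = al by rewrite /F /loglog expRK ln1 cos0 sin0; ring.
rewrite le_eqVlt => /predU1P[<-|et].
  by rewrite set_itv1 Rintegral_set1 -[X in _ - X]Fe subrr.
have dF (x : R) : 1 < x -> is_derive x 1 F (loglog 0 (al + be) (be - al) x / x).
  exact: is_derive_ln_loglog.
have cF (x : R) : 1 < x -> {for x, continuous F}.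
  move=> x1; apply: differentiable_continuous; apply/derivable1_diffP.
  by case: (dF x x1).
rewrite /Rintegral (@continuous_FTC2 _ _ F) //.
- by rewrite -EFinB /= Fe.
- apply: continuous_in_subspaceT => x; rewrite inE /= in_itv /= => /andP[ex _].
  apply: cvgM; first by apply: continuous_loglog; lra.
  by apply: cvgV; [rewrite gt_eqF //; lra|exact: cvg_id].
- split.
  + by move=> x; rewrite in_itv /= => /andP[ex _]; case: (dF x); first lra.
  + by apply: cvg_at_right_filter; apply: cF.
  + by apply: cvg_at_left_filter; apply: cF; lra.
- move=> x; rewrite in_itv /= => /andP[ex _].
  by rewrite derive1E; case: (dF x); first lra.
Qed.

Definition linv t : R := if e <= t then (ln t)^-1 else 0.

(** The primitive from [loglog_integral] is divided by ln t; its value [al] at [e] leaves the term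
    in [linv]. Below [e] both sides vanish, in either branch of [Mop]. *)
Lemma Mop_osc al be t : 0 < t ->
  Mop (osc (al + be) (be - al)) t = osc al be t - al * linv t.
Proof.
move=> t0; have e1 := @e_gt1 R; rewrite /Mop /linv.
pose x := osc (al + be) (be - al).
have x0 s : s < e -> x s / s = 0 by move=> se; rewrite /x /osc leNgt se /= mul0r.
have [et|te] := leP e t; last first.
  rewrite [osc al be t]/osc [e <= t]leNgt te /= mulr0 subr0; case: ifP => _.
    rewrite (@eq_Rintegral _ _ _ _ _ (cst 0)); last first.
      by move=> s; rewrite inE /= in_itv /= => /andP[_ st]; apply: x0; lra.
    by rewrite Rintegral_cst // mul0r mulr0.
  rewrite (@eq_Rintegral _ _ _ _ _ (cst 0)); last first.
    by move=> s; rewrite inE /= in_itv /= => /andP[_ st]; apply: x0; lra.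
  by rewrite Rintegral_cst // mul0r oppr0 mulr0.
have -> : 1 <= t by lra.
have l0 : 0 < ln t by rewrite ln_gt0; lra.
have IE : `[1, t]%classic `&` `[e, t]%classic = `[e, t]%classic.
  apply/seteqP; split=> s /=; first by case.
  by rewrite !in_itv /= => /andP[es st]; rewrite es st; split=> //; rewrite andbT; lra.
have -> : \int[leb]_(s in `[1, t]) (osc (al + be) (be - al) s / s) =
    \int[leb]_(s in `[e, t]) (loglog 0 (al + be) (be - al) s / s).
  rewrite -IE Rintegral_mkcondr; apply: eq_Rintegral => s.
  rewrite inE /= in_itv /= => /andP[s1 st]; rewrite /patch mem_setE in_itv /= st andbT.
  by rewrite /osc /loglog; case: (leP e s) => es; rewrite ?add0r ?mul0r.
rewrite loglog_integral // mulrBr mulKf ?gt_eqF //; congr (_ - _); last by rewrite mulrC.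
by rewrite /loglog /osc et add0r.
Qed.

Lemma measurable_ge_e (f : R -> R) : measurable_fun setT f ->
  measurable_fun (@pos_half R) (fun t => if e <= t then f t else 0).
Proof.
move=> mf; apply: measurable_funS (_ : measurable_fun setT _) => //.
apply: measurable_fun_ifT => //.
apply: measurable_fun_ler => //.
Qed.

Lemma Linf_osc al be : Linf (osc al be : R -> R).
Proof.
apply: (@Linf_bounded _ _ (`|al| + `|be|)).
  apply: measurable_ge_e.
  have m1 : measurable_fun setT (fun t : R => ln (ln t)).
    by apply: measurableT_comp; exact: measurable_ln.
  apply: measurable_funD; apply: measurable_funM => //.
    by apply: measurableT_comp m1; apply: continuous_measurable_fun; exact: continuous_cos.
  by apply: measurableT_comp m1; apply: continuous_measurable_fun; exact: continuous_sin.
move=> t t0; rewrite /osc; case: ifP => _; last by rewrite normr0 addr_ge0.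
rewrite (le_trans (ler_normD _ _)) // !normrM lerD // ler_piMr // ler_norml;
  by rewrite ?cos_geN1 ?cos_le1 ?sin_geN1 ?sin_le1.
Qed.

Lemma Linf_linv : Linf (linv : R -> R).
Proof.
apply: (@Linf_bounded _ _ 1).
  (* The maximum changes nothing from [e] on and makes the function monotone on the whole line,
     hence measurable. *)
  have -> : linv = fun t => if e <= t then (Num.max 1 (ln t))^-1 else 0.
    apply/funext => t; rewrite /linv; case: ifP => // et.
    by rewrite max_r // ln_ge1.
  apply: measurable_ge_e; apply: nonincreasing_measurable => // s t st.
  have m1 u : 1 <= Num.max 1 (ln u) :> R by rewrite le_max lexx.
  have m0 u : 0 < Num.max 1 (ln u) :> R by exact: lt_le_trans (m1 u).
  rewrite lef_pV2 ?posrE //; have [s0|s0] := leP s 0; first by rewrite ln0 // max_l.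
  have lst : ln s <= ln t by rewrite ler_ln ?posrE ?(lt_le_trans s0).
  by rewrite ge_max m1 /= le_max lst orbT.
move=> t t0; rewrite /linv; case: ifP => et; last by rewrite normr0.
have l1 := ln_ge1 et; have l0 : 0 < ln t by lra.
by rewrite ger0_norm ?invr_ge0 ?(ltW l0) // invf_le1.
Qed.

Lemma linv_le t : 0 < t -> `|linv t| <= 2 * (ln (1 + t))^-1.
Proof.
move=> t0; have e1 := @e_gt1 R; have l0 : 0 < ln (1 + t) by rewrite ln_gt0 // ltrDl.
rewrite /linv; case: ifP => et; last by rewrite normr0 mulr_ge0 // invr_ge0 ltW.
have l1 := ln_ge1 et; have lt0 : 0 < ln t by lra.
rewrite ger0_norm ?invr_ge0 ?(ltW lt0) // ler_pdivlMr // mulrC ler_pdivrMr //.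
(* It remains to see that 1 + t <= t^2, which holds as t >= e >= 2. *)
have -> : 2 * ln t = ln (t ^+ 2) by rewrite lnXn // mulr_natl.
have e2 : 2 <= e by have := expR_ge1Dx (1 : R); lra.
have t2 : 2 <= t by lra.
rewrite ler_ln ?posrE; [|lra|by rewrite exprn_gt0].
have : 0 <= t * (t - 2) by rewrite mulr_ge0; lra.
rewrite expr2; lra.
Qed.

Lemma om_osc_linear om al be : ext_limit om ->
  om (osc al be) = al * om (osc 1 0) + be * om (osc 0 1).
Proof.
move=> hom.
have h1 := LinfZ al (Linf_osc 1 0); have h2 := LinfZ be (Linf_osc 0 1).
rewrite -!om_scale //; try exact: Linf_osc.
rewrite -om_add //; apply: (@om_eq_small _ _ hom _ _ 0) => //.
- exact: Linf_osc.
- exact: LinfD.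
move=> t t0; rewrite mul0r /osc; case: ifP => _; rewrite normr_le0; apply/eqP; ring.
Qed.

Lemma om_Mop_osc om al be : DM_omega om ->
  om (osc (al + be) (be - al)) = om (osc al be).
Proof.
move=> [[hom _] hM]; have Lx := Linf_osc (al + be) (be - al).
have Ly : Linf (fun t => osc al be t + - al * linv t).
  by apply: LinfD; [exact: Linf_osc|apply: LinfZ; exact: Linf_linv].
have Mx t : 0 < t -> Mop (osc (al + be) (be - al)) t = osc al be t + - al * linv t.
  by move=> t0; rewrite Mop_osc // mulNr.
have LM : Linf (Mop (osc (al + be) (be - al))).
  case: Ly => [my [c hc]]; split.
    apply: (@eq_measurable_fun _ _ _ _ (@pos_half R)
      (fun t : R => osc al be t + - al * linv t)) => // t.
    by rewrite inE pos_halfE => t0; exact/esym/Mx.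
  exists c; apply: (@filterS _ _ (@ae_leb_filter R) _ _ _ hc) => t h; rewrite pos_halfE => t0.
  by rewrite Mx //; apply: h; rewrite pos_halfE.
rewrite -hM //.
have -> : om (Mop (osc (al + be) (be - al))) = om (fun t => osc al be t + - al * linv t).
  by apply: (@om_eq_small _ _ hom _ _ 0) => // t t0; rewrite Mx // subrr normr0 mul0r.
rewrite om_add //; [|exact: Linf_osc|apply: LinfZ; exact: Linf_linv].
rewrite om_scale //; last exact: Linf_linv.
by rewrite (om_small hom Linf_linv linv_le) mulr0 addr0.
Qed.

(* [osc 1 0] and [osc 0 1] span an [M]-invariant plane modulo functions vanishing
   at infinity, on which [M] has no eigenvalue 1. *)
Lemma DM_osc_eq0 om : DM_omega om -> om (osc 1 0) = 0.
Proof.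
move=> h; have hom := h.1.1.
(* Writing c and s for the values on [osc 1 0] and [osc 0 1], these say c = (c + s) / 2 and s = (s -
   c) / 2. *)
have := om_Mop_osc 2^-1 2^-1 h; have := om_Mop_osc (- 2^-1) 2^-1 h.
rewrite (_ : 2^-1 + 2^-1 = 1) 1?(_ : 2^-1 - 2^-1 = 0) 1?(_ : - 2^-1 + 2^-1 = 0)
  1?(_ : 2^-1 - - 2^-1 = 1); try lra.
rewrite (om_osc_linear (- 2^-1)) // (om_osc_linear 2^-1) //; lra.
Qed.

End MopOscillation.

(** * Dixmier traces from logarithmic windows *)

Section LebesgueScaling.
Variable R : realType.
Local Notation leb := (@lebesgue_measure R).
Variable b : R.
Hypothesis b0 : 0 < b.

Lemma measurable_div : measurable_fun setT (fun s : R => s / b).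
Proof. by apply: measurable_funM; [exact: measurable_id|exact: measurable_cst]. Qed.

Let pf : {measure set (measurableTypeR R) -> \bar R} :=
  measure_function_pushforward__canonical__measure_function_Measure leb
    (measurable_div : @measurable_fun _ _ (measurableTypeR R) (measurableTypeR R) setT _).
Let bV : {nonneg R} := NngNum (ltW (eq_ind_r is_true b0 (invr_gt0 b) : 0 < b^-1)).
Let bP : {nonneg R} := NngNum (ltW b0).

(** The pushforward of Lebesgue measure under division by [b], multiplied by [b^-1], agrees with it
    on half-open intervals, and these determine it. *)
Lemma lebesgue_measure_div (A : set R) : measurable A ->
  leb ((fun s => s / b) @^-1` A) = (b%:E * leb A)%E.
Proof.
move=> mA; have h X : ocitv X -> leb X = mscale bV pf X.
  move=> [[c d] _ <-] /=; rewrite /mscale /= /pushforward.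
  have -> : (fun s => s / b) @^-1` `]c, d]%classic = `](b * c), (b * d)]%classic.
    by apply/seteqP; split=> s /=; rewrite !in_itv /= ltr_pdivlMr // ler_pdivrMr // ![_ * b]mulrC.
  rewrite !lebesgue_measure_itv /= !lte_fin ltr_pM2l //; case: ifP => _; last by rewrite mule0.
  by rewrite -EFinD -EFinM; congr (_%:E); rewrite -mulrBr mulKf ?gt_eqF.
have := @lebesgue_measure_unique R
  (measure_function_mscale__canonical__measure_function_Measure bV pf) h A mA.
rewrite /mscale /= /pushforward => ->.
by rewrite muleA -EFinM divff ?gt_eqF // mul1e.
Qed.

Lemma ge0_integral_div (D : set R) (h : R -> \bar R) : measurable D ->
  measurable_fun D h -> (forall u, 0 <= h u)%E ->
  (\int[leb]_(s in (fun s : R => s / b)%R @^-1` D) ((b^-1)%:E * h (s / b)%R) =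
   \int[leb]_(u in D) h u)%E.
Proof.
move=> mD mh h0.
have mk : measurable_fun D (fun u => (b^-1)%:E * h u)%E by apply: measurable_funeM.
have k0 u : (0 <= (b^-1)%:E * h u)%E by rewrite mule_ge0 // lee_fin invr_ge0 ltW.
have := @ge0_integral_pushforward _ _ (measurableTypeR R) (measurableTypeR R) R _
  measurable_div leb D _ mD mk (fun y _ => k0 y).
move=> /= <-.
rewrite (@eq_measure_integral _ (measurableTypeR R) _ D
  (measure_function_mscale__canonical__measure_function_Measure bP leb) pf); last first.
  by move=> A mA _; rewrite /mscale /=; exact: lebesgue_measure_div.
rewrite ge0_integral_mscale //= ge0_integralZl_EFin ?invr_ge0 ?(ltW b0) //.
by rewrite muleA -EFinM divff ?gt_eqF // mul1e.
Qed.

(** The factor [b^-1] of the change of variables turns 1 / (s / b) into 1 / s. *)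
Lemma Rintegral_dilate (x : R -> R) (p q : R) : 0 < p ->
  measurable_fun `[p / b, q / b]%classic (fun u => x u / u) ->
  \int[leb]_(s in `[p, q]) (x (s / b) / s) = \int[leb]_(u in `[p / b, q / b]) (x u / u).
Proof.
move=> p0 mx; congr fine; set D := `[p / b, q / b]%classic.
have DE : `[p, q]%classic = (fun s => s / b) @^-1` D.
  by apply/seteqP; split=> s; rewrite /D /= !in_itv /= !ler_pM2r ?invr_gt0.
have mD : measurable D by exact: measurable_itv.
have mE : measurable_fun D (fun u => (x u / u)%:E) by apply/measurable_EFinP.
(* The change of variables is available for nonnegative functions, so positive and negative parts
   are treated separately. *)
rewrite integralE [RHS]integralE DE; congr (_ - _)%E.
  rewrite -(ge0_integral_div mD (measurable_funepos mE)) //; apply: eq_integral => s _.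
  rewrite !funeposE -!EFin_max -EFinM; congr (_%:E).
  rewrite maxr_pMr ?invr_ge0 ?(ltW b0) // mulr0; congr Num.max.
  by rewrite invf_div mulrCA mulKf ?gt_eqF.
rewrite -(ge0_integral_div mD (measurable_funeneg mE)) //; apply: eq_integral => s _.
rewrite !funenegE -!EFinN -!EFin_max -EFinM; congr (_%:E).
rewrite maxr_pMr ?invr_ge0 ?(ltW b0) // mulr0; congr Num.max.
by rewrite mulrN invf_div mulrCA mulKf ?gt_eqF.
Qed.

End LebesgueScaling.

(** * Integrals against ds / s *)

Section LogIntegral.
Variable R : realType.
Local Notation leb := (@lebesgue_measure R).
Implicit Types (x y : R -> R) (p q : R).

Definition log_integral x p q : R := \int[leb]_(s in `[p, q]) (x s / s).

Lemma integral_cst_div (k : R) p q : 0 < p -> p <= q ->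
  (\int[leb]_(s in `[p, q]) (k / s)%:E)%E = (k * (ln q - ln p))%:E.
Proof.
move=> p0; rewrite le_eqVlt => /predU1P[<-|pq].
  by rewrite set_itv1 integral_set1 subrr mulr0.
have dF (s : R) : 0 < s -> is_derive s 1 (fun s => k * ln s) (k / s).
  by move=> s0; have d1 := is_derive1_ln s0; apply: is_derive_eq.
have cF (s : R) : 0 < s -> {for s, continuous (fun s => k * ln s)}.
  move=> s0; apply: differentiable_continuous; apply/derivable1_diffP.
  by case: (dF s s0).
rewrite (@continuous_FTC2 _ _ (fun s => k * ln s)) //.
- by rewrite -EFinB -mulrBr.
- apply: continuous_in_subspaceT => s; rewrite inE /= in_itv /= => /andP[ps _].
  apply: cvgMl_tmp; apply: cvgV; last exact: cvg_id.
  by rewrite gt_eqF // (lt_le_trans p0).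
- split.
  + by move=> s; rewrite in_itv /= => /andP[ps _]; case: (dF s (lt_trans p0 ps)).
  + by apply: cvg_at_right_filter; apply: cF.
  + by apply: cvg_at_left_filter; apply: cF; exact: lt_trans pq.
move=> s; rewrite in_itv /= => /andP[ps _].
by rewrite derive1E; case: (dF s (lt_trans p0 ps)).
Qed.

Lemma measurable_div_id x p q : 0 < p -> measurable_fun (@pos_half R) x ->
  measurable_fun `[p, q]%classic (fun s => x s / s).
Proof.
move=> p0 mx; apply: (measurable_funS (E := @pos_half R)); first exact: measurable_pos_half.
  by move=> s /=; rewrite in_itv /= => /andP[ps _]; rewrite pos_halfE (lt_le_trans p0).
apply: measurable_funM => //; apply: open_continuous_measurable_fun; first exact: interval_open.
move=> s; rewrite inE pos_halfE => s0; apply: cvgV; last exact: cvg_id.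
by rewrite gt_eqF.
Qed.

Section Bound.
Variables (x : R -> R) (k p q : R).
Hypotheses (mx : measurable_fun (@pos_half R) x) (p0 : 0 < p) (pq : p <= q) (k0 : 0 <= k).
Hypothesis hx : {ae leb, forall s, `[p, q]%classic s -> `|x s| <= k}.

Let abs_bound : (\int[leb]_(s in `[p, q]) `|(x s / s)%:E| <= (k * (ln q - ln p))%:E)%E.
Proof.
rewrite -integral_cst_div //; have m1 := measurable_div_id (q := q) p0 mx.
apply: ae_ge0_le_integral => //.
- by apply: measurableT_comp => //; apply/measurable_EFinP.
- move=> s /=; rewrite in_itv /= => /andP[ps _]; rewrite lee_fin divr_ge0 //.
  by rewrite ltW // (lt_le_trans p0).
- apply/measurable_EFinP; apply: (measurable_div_id (x := cst k)) => //.
apply: (@filterS _ _ (@ae_leb_filter R) _ _ _ hx) => s h ps.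
have s0 : 0 < s by move: ps => /=; rewrite in_itv /= => /andP[ps _]; exact: lt_le_trans ps.
by rewrite lee_fin normrM [`|s^-1|]ger0_norm ?invr_ge0 ?(ltW s0) // ler_pM2r ?invr_gt0 // h.
Qed.

Lemma log_integrable : leb.-integrable `[p, q]%classic (EFin \o (fun s => x s / s)).
Proof.
apply/integrableP; split; first by apply/measurable_EFinP; exact: measurable_div_id.
by apply: le_lt_trans abs_bound _; rewrite ltry.
Qed.

Lemma log_integral_le : `|log_integral x p q| <= k * (ln q - ln p).
Proof.
rewrite -lee_fin EFin_normr_Rintegral //; last exact: log_integrable.
apply: le_trans abs_bound; apply: le_abse_integral => //.
by apply/measurable_EFinP; exact: measurable_div_id.
Qed.

End Bound.

Lemma log_integral_ge0 x p q : measurable_fun (@pos_half R) x -> 0 < p ->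
  {ae leb, forall s, pos_half s -> 0 <= x s} -> 0 <= log_integral x p q.
Proof.
move=> mx p0 hx; have m1 := measurable_div_id (q := q) p0 mx; rewrite /log_integral /Rintegral.
(* The sign of [x] is known only almost everywhere; the integrand is replaced by its absolute
   value. *)
rewrite (@ae_eq_integral _ _ _ leb `[p, q]%classic (fun s => `|(x s / s)%:E|%E)) //.
- by apply: fine_ge0; apply: integral_ge0.
- by apply/measurable_EFinP.
- by apply: measurableT_comp => //; apply/measurable_EFinP.
apply: (@filterS _ _ (@ae_leb_filter R) _ _ _ hx) => s h ps.
have s0 : 0 < s by move: ps => /=; rewrite in_itv /= => /andP[ps _]; exact: lt_le_trans ps.
by rewrite /= ger0_norm // divr_ge0 ?(ltW s0) // h // pos_halfE.
Qed.

Section LinfIntegral.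
Variables (x : R -> R) (c : R).
Hypotheses (mx : measurable_fun (@pos_half R) x) (c0 : 0 <= c).
Hypothesis hc : {ae leb, forall t, pos_half t -> `|x t| <= c}.

Lemma ae_window p q : 0 < p -> {ae leb, forall s, `[p, q]%classic s -> `|x s| <= c}.
Proof.
move=> p0; apply: (@filterS _ _ (@ae_leb_filter R) _ _ _ hc) => s h /=.
by rewrite in_itv /= => /andP[ps _]; apply: h; rewrite pos_halfE (lt_le_trans p0).
Qed.

Lemma Linf_log_integrable p q : 0 < p -> p <= q ->
  leb.-integrable `[p, q]%classic (EFin \o (fun s => x s / s)).
Proof. by move=> p0 pq; apply: (log_integrable mx p0 pq c0); exact: ae_window. Qed.

Lemma Linf_log_integral_le p q : 0 < p -> p <= q -> `|log_integral x p q| <= c * (ln q - ln p).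
Proof. by move=> p0 pq; apply: log_integral_le => //; exact: ae_window. Qed.

Lemma log_integral_split p m q : 0 < p -> p <= m -> m <= q ->
  log_integral x p q = log_integral x p m + log_integral x m q.
Proof.
move=> p0 pm mq; have pq := le_trans pm mq; have hi := Linf_log_integrable p0 pq.
apply/eqP; rewrite addrC -subr_eq; apply/eqP; rewrite /log_integral.
rewrite Rintegral_itvB ?bnd_simp // Rintegral_itv_obnd_cbnd //.
apply: integrableS hi => // s /=; rewrite !in_itv /= => /andP[h1 ->]; rewrite andbT.
by rewrite ltW // (le_lt_trans pm).
Qed.

(** On the logarithmic scale a dilation shifts the window by ln b, so the old and new windows differ
    by two intervals of length |ln b|. The sign of ln b decides the direction of the shift. *)
Lemma log_integral_dilate_near b p q : 0 < b -> 0 < p -> p <= q ->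
  `|log_integral (fun s => x (s / b)) p q - log_integral x p q| <= 2 * (c * `|ln b|).
Proof.
move=> b0 p0 pq; have q0 := lt_le_trans p0 pq.
have pb0 : 0 < p / b by rewrite divr_gt0.
have qb0 : 0 < q / b by rewrite divr_gt0.
have pqb : p / b <= q / b by rewrite ler_pM2r ?invr_gt0.
have -> : log_integral (fun s => x (s / b)) p q = log_integral x (p / b) (q / b).
  by apply: Rintegral_dilate => //; exact: measurable_div_id.
have lnb r : 0 < r -> ln (r / b) = ln r - ln b by move=> r0; rewrite ln_div ?posrE.
have [b1|b1] := leP 1 b.
  have lb : 0 <= ln b by rewrite ln_ge0.
  have div_le r : 0 < r -> r / b <= r by move=> r0; rewrite ler_pdivrMr // ler_peMr // ltW.
  have s1 := log_integral_split pb0 (div_le _ p0) pq.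
  have s2 := log_integral_split pb0 pqb (div_le _ q0).
  have := Linf_log_integral_le pb0 (div_le _ p0).
  have := Linf_log_integral_le qb0 (div_le _ q0).
  rewrite !lnb // !opprB ![ln _ + (ln b - _)]addrCA !subrr !addr0 (ger0_norm lb) !ler_norml.
  by move=> /andP[h1 h2] /andP[h3 h4]; apply/andP; split; lra.
have lb : ln b <= 0 by rewrite ln_le0 // ltW.
have div_ge r : 0 < r -> r <= r / b by move=> r0; rewrite ler_pdivlMr // ler_piMr ?(ltW r0) // ltW.
have s1 := log_integral_split p0 (div_ge _ p0) pqb.
have s2 := log_integral_split p0 pq (div_ge _ q0).
have := Linf_log_integral_le p0 (div_ge _ p0).
have := Linf_log_integral_le q0 (div_ge _ q0).
rewrite !lnb // ![ln _ - ln b - _]addrAC !subrr !sub0r (ler0_norm lb) !ler_norml.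
by move=> /andP[h1 h2] /andP[h3 h4]; apply/andP; split; lra.
Qed.

End LinfIntegral.
End LogIntegral.

Lemma ultra_fmap (T S : Type) (f : T -> S) (F : set_system T) :
  UltraFilter F -> UltraFilter (f @ F).
Proof.
move=> uF; split; first exact: fmap_proper_filter.
move=> G pG FG; apply/seteqP; split=> // A GA.
have [//|nA] := in_ultra_setVsetC (f @^-1` A) uF.
have GnA : G (~` A) by apply: FG.
by have [x []] := filter_ex (filterI GA GnA).
Qed.

(** * Ultrafilter limits of window means *)

Section WindowLimit.
Variable R : realType.
Local Notation leb := (@lebesgue_measure R).
Variables (a c : nat -> R) (U : set_system nat).
Hypotheses (a0 : forall n, 0 < a n) (ac : forall n, a n < c n).
Hypothesis a_infty : a @ \oo --> +oo.
Let L n := ln (c n) - ln (a n).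
Hypothesis L_infty : L @ \oo --> +oo.
Hypotheses (ultraU : UltraFilter U) (oU : \oo `<=` U).
Implicit Types x y : R -> R.

Let FU : ProperFilter U. Proof. exact: ultra_proper. Qed.

Definition window_mean x n : R := log_integral x (a n) (c n) / L n.

Definition window_lim x : R := lim (window_mean x @ U).

Lemma L_gt0 n : 0 < L n.
Proof. by rewrite subr_gt0 ltr_ln ?posrE // (lt_trans (a0 n)). Qed.

Lemma cvg_oo_U (u : nat -> R) (l : R) : u @ \oo --> l -> u @ U --> l.
Proof. by move=> h A /h; exact: oU. Qed.

Lemma Linf_bound x : Linf x -> exists2 k, 0 <= k &
  {ae leb, forall t, pos_half t -> `|x t| <= k}.
Proof.
move=> [_ [k hk]]; exists `|k| => //.
by apply: (@filterS _ _ (@ae_leb_filter R) _ _ _ hk) => t h /h /le_trans; apply; exact: ler_norm.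
Qed.

(** The means of a bounded function stay in a compact segment, where every ultrafilter converges. *)
Lemma window_mean_cvg x : Linf x -> window_mean x @ U --> window_lim x.
Proof.
move=> hx; have [k k0 hk] := Linf_bound hx.
have hb n : `|window_mean x n| <= k.
  rewrite normrM [`|(L n)^-1|]ger0_norm ?invr_ge0 ?(ltW (L_gt0 n)) // ler_pdivrMr ?L_gt0 //.
  by apply: (Linf_log_integral_le hx.1 k0 hk); [exact: a0|exact: ltW].
have := @segment_compact R (- k) k; rewrite compact_ultra.
move=> /(_ (window_mean x @ U) (ultra_fmap _ ultraU))[].
  by apply: nearW => n /=; rewrite in_itv /= -ler_norml.
move=> l [_ hl]; apply/cvg_ex; by exists l.
Qed.

Lemma window_lim_eq x (l : R) : window_mean x @ U --> l -> window_lim x = l.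
Proof. by move=> h; apply/cvg_lim. Qed.

Lemma window_mean_add x y n : Linf x -> Linf y ->
  window_mean (fun t => x t + y t) n = window_mean x n + window_mean y n.
Proof.
move=> hx hy; have [k k0 hk] := Linf_bound hx; have [j j0 hj] := Linf_bound hy.
rewrite /window_mean -mulrDl; congr (_ / _); rewrite /log_integral -RintegralD //.
- by apply: eq_Rintegral => s _; rewrite mulrDl.
- exact: (Linf_log_integrable hx.1 k0 hk (a0 n) (ltW (ac n))).
- exact: (Linf_log_integrable hy.1 j0 hj (a0 n) (ltW (ac n))).
Qed.

Lemma window_mean_scale (r : R) x n : Linf x ->
  window_mean (fun t => r * x t) n = r * window_mean x n.
Proof.
move=> hx; have [k k0 hk] := Linf_bound hx.
rewrite /window_mean mulrA; congr (_ / _); rewrite /log_integral -RintegralZl //.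
- by apply: eq_Rintegral => s _; rewrite mulrA.
- exact: (Linf_log_integrable hx.1 k0 hk (a0 n) (ltW (ac n))).
Qed.

Lemma window_mean_cst (r : R) n : window_mean (fun=> r) n = r.
Proof.
rewrite /window_mean /log_integral /Rintegral (integral_cst_div _ (a0 n) (ltW (ac n))) /=.
by rewrite mulfK // gt_eqF // L_gt0.
Qed.

Lemma window_mean_le x (k : R) n : Linf x -> 0 <= k ->
  (forall s, a n <= s <= c n -> `|x s| <= k) -> `|window_mean x n| <= k.
Proof.
move=> hx k0 h.
rewrite normrM [`|(L n)^-1|]ger0_norm ?invr_ge0 ?(ltW (L_gt0 n)) // ler_pdivrMr ?L_gt0 //.
apply: (log_integral_le hx.1 (a0 n) (ltW (ac n)) k0); apply: aeW => s /=.
by rewrite in_itv /=; exact: h.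
Qed.

Lemma window_mean_ge x (k : R) n : Linf x ->
  (forall s, a n <= s <= c n -> k <= x s) -> k <= window_mean x n.
Proof.
move=> hx h; have hi (z : R -> R) : Linf z ->
    leb.-integrable `[a n, c n]%classic (EFin \o (fun s => z s / s)).
  move=> hz; have [j j0 hj] := Linf_bound hz.
  exact: (Linf_log_integrable hz.1 j0 hj (a0 n) (ltW (ac n))).
rewrite -[k](window_mean_cst k n) ler_pM2r ?invr_gt0 ?L_gt0 //.
apply: le_Rintegral => //; [exact: (hi _ (Linf_cst k))|exact: hi|].
move=> s /=; rewrite in_itv /= => hs; have s0 : 0 < s by case/andP: hs => /(lt_le_trans (a0 n)).
by rewrite ler_pM2r ?invr_gt0 // h.
Qed.

Lemma window_lim_dixmier : dixmier_omega window_lim.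
Proof.
split; first split.
- move=> x y hx hy; apply: window_lim_eq.
  rewrite (_ : window_mean _ = fun n => window_mean x n + window_mean y n).
    by apply: cvgD; exact: window_mean_cvg.
  by apply/funext => n; exact: window_mean_add.
- move=> r x hx; apply: window_lim_eq.
  rewrite (_ : window_mean _ = fun n => r * window_mean x n).
    by apply: cvgMl_tmp; exact: window_mean_cvg.
  by apply/funext => n; exact: window_mean_scale.
- move=> x hx h; apply: limr_ge; first by apply/cvg_ex; exists (window_lim x); exact: window_mean_cvg.
  apply: nearW => n; rewrite divr_ge0 ?(ltW (L_gt0 n)) //.
  exact: (log_integral_ge0 (c n) hx.1 (a0 n) h).
- move=> x l hx hl; apply: window_lim_eq; apply: cvg_oo_U.
  apply/cvgrPdist_le => e e0.
  have hy : Linf (fun t => x t + (- l)) by apply: LinfD => //; exact: Linf_cst.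
  move/cvgrPdist_le : hl => /(_ e e0) [M [_ hM]].
  (* Eventually the whole window lies beyond [M], where [x] is within [e] of [l]. *)
  move/cvgryPgt : a_infty => /(_ M); apply: filterS => n hn.
  have mE : window_mean (fun t => x t + - l) n = window_mean x n - l.
    by rewrite window_mean_add ?window_mean_cst //; exact: Linf_cst.
  rewrite distrC -mE; apply: window_mean_le hy (ltW e0) _ => s /andP[sa _].
  by have := hM s (lt_le_trans hn sa); rewrite distrC.
move=> x hx b b0; apply: window_lim_eq; have [k k0 hk] := Linf_bound hx.
rewrite -[window_lim x]addr0.
rewrite (_ : window_mean _ = fun n => window_mean x n +
   (window_mean (fun t => x (t / b)) n - window_mean x n)); last first.
  by apply/funext => n; rewrite addrC subrK.
apply: cvgD; first exact: window_mean_cvg.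
apply: cvg_oo_U; apply/cvgrPdist_le => e e0.
move/cvgryPgt : L_infty => /(_ (2 * (k * `|ln b|) / e)); apply: filterS => n hn.
rewrite sub0r normrN /window_mean -mulrBl normrM.
rewrite [`|(L n)^-1|]ger0_norm ?invr_ge0 ?(ltW (L_gt0 n)) // ler_pdivrMr ?L_gt0 //.
apply: le_trans (log_integral_dilate_near hx.1 k0 hk b0 (a0 n) (ltW (ac n))) _.
by rewrite [e * _]mulrC -ler_pdivrMr // ltW.
Qed.

End WindowLimit.

Section Windows.
Variable R : realType.
Implicit Types (s t : R).

Lemma cos_ge_cos1 t : -1 <= t <= 1 -> cos 1 <= cos t.
Proof.
wlog t0 : t / 0 <= t => [H|].
  have [|/ltW t0] := leP 0 t; first exact: H.
  by move=> h; rewrite -[cos t]cosN; apply: H; [lra|case/andP: h => *; apply/andP; split; lra].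
have := @pi_ge2 R => p2 /andP[_ t1]; rewrite leNgt ltr_cos ?in_itv /= ?t0 ?t1 //=; lra.
Qed.

(** The parity of [j] selects windows around even or odd multiples of pi, where [(-1) ^+ j] times
    the cosine is at least cos 1. *)
Lemma dixmier_omega_osc (j : nat) : exists om : (R -> R) -> R,
  dixmier_omega om /\ cos 1 <= (-1) ^+ j * om (osc 1 0).
Proof.
(* Using [n.+1] instead of [n] gives [w n >= 2], which places every window beyond [e], where [osc]
   is not cut off. *)
pose w n : R := pi *+ (n.+1.*2 + j).
pose a n := expR (expR (w n - 1)); pose c n := expR (expR (w n + 1)).
have p2 := @pi_ge2 R.
have wn n : n%:R + 2 <= w n.
  have h : (n%:R + 2 : R) <= (n.+1.*2 + j)%:R.
    by rewrite -[2]/(2%:R) -natrD ler_nat -addnn addn2 addSn addnS !addSn !ltnS -addnA leq_addr.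
  rewrite /w -[pi *+ _]mulr_natl (le_trans h) // ler_peMr ?ler0n //; lra.
have n0 n : (0 : R) <= n%:R by rewrite ler0n.
have ex (y : R) : 1 + y <= expR y by exact: expR_ge1Dx.
have an n : n%:R <= a n.
  by have := ex (expR (w n - 1)); have := ex (w n - 1); have := wn n; rewrite /a; lra.
have Ln n : n%:R <= ln (c n) - ln (a n).
  (* The logarithmic length is exp (w n - 1) (exp 2 - 1), and exp 2 >= 3. *)
  rewrite /a /c !expRK (_ : w n + 1 = w n - 1 + 2); last by ring.
  rewrite expRD; have h1 := ex 2; have h2 := ex (w n - 1); have := wn n => h3.
  have h4 : 0 <= expR (w n - 1) by exact: expR_ge0.
  have h5 : expR (w n - 1) * 3 <= expR (w n - 1) * expR 2 by rewrite ler_wpM2l //; lra.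
  lra.
have ea n : expR 1 <= a n.
  by rewrite /a ler_expR; have := ex (w n - 1); have := wn n; have := n0 n; lra.
have [U [uU oU]] := @ultraFilterLemma nat \oo _.
have to_infty (u : nat -> R) : (forall n, n%:R <= u n) -> u @ \oo --> +oo.
  move=> hu; apply/cvgryPgt => M; near=> n; apply: lt_le_trans (hu n).
  by near: n; exact: nbhs_infty_gtr.
have a0 n : 0 < a n by exact: expR_gt0.
have ac n : a n < c n by rewrite /a /c !ltr_expR; lra.
have dom := window_lim_dixmier a0 ac (to_infty _ an) (to_infty _ Ln) uU oU.
exists (window_lim a c U); split=> //.
rewrite -(om_scale dom.1 _ (Linf_osc 1 0)); set x := (fun t : R => (-1) ^+ j * osc 1 0 t).
have Lx : Linf x by apply: LinfZ; exact: Linf_osc.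
have FU : ProperFilter U by exact: ultra_proper.
apply: limr_ge.
  apply/cvg_ex; exists (window_lim a c U x).
  exact: (window_mean_cvg a0 ac uU Lx).
apply: nearW => n; apply: (window_mean_ge a0 ac Lx) => s /andP[as_ sc].
have es := le_trans (ea n) as_; have s0 : 0 < s by exact: lt_le_trans (a0 n) as_.
have l1 := ln_ge1 es; have l0 : 0 < ln s by lra.
rewrite /x /osc es mul1r mul0r addr0.
have b1 : w n - 1 <= ln (ln s).
  rewrite -[leLHS]expRK ler_ln ?posrE ?expR_gt0 // -[leLHS]expRK ler_ln ?posrE ?expR_gt0 //.
have b2 : ln (ln s) <= w n + 1.
  by rewrite -[leRHS]expRK ler_ln ?posrE ?expR_gt0 // -[leRHS]expRK ler_ln ?posrE ?expR_gt0.
(* Shifting by the multiple [w n] of pi produces the sign [(-1) ^+ j] once more, which cancels the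
   one in [x]. *)
rewrite -(subrK (w n) (ln (ln s))) (alternatingn (@cosDpi R)) mulrA -exprD.
rewrite -signr_odd oddD oddD odd_double /= addbb mul1r.
by apply: cos_ge_cos1; apply/andP; split; lra.
Unshelve. all: by end_near. Qed.

End Windows.

(** * The operator that separates the two classes *)

Section Counterexample.
Variable R : realType.
Implicit Types om : (R -> R) -> R.

Definition osc_op : op R := diag_op (@osc_seq R).

Lemma sing_val_osc n : sing_val n osc_op = osc_seq R n.
Proof. by apply: sing_val_diag; [exact: osc_seq_ge0|exact: osc_seq_noninc]. Qed.

Lemma osc_op_bounded : is_bounded_op osc_op.
Proof. by apply: diag_op_bounded; [exact: osc_seq_ge0|exact: osc_seq_noninc]. Qed.

Lemma osc_op_pos_L1inf : pos_L1inf osc_op.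
Proof.
split; first by apply: diag_op_pos; [exact: osc_seq_ge0|exact: osc_seq_noninc].
by split; [exact: osc_op_bounded|exists 6 => n; rewrite sing_val_osc osc_seq_le].
Qed.

Lemma pos_L1inf0 : pos_L1inf (fun (_ : vec R) (_ : nat) => 0 : R[i]).
Proof. by split; [exact: is_pos_op0|exact: L1inf0]. Qed.

Lemma dixmier_trace0 om : ext_limit om -> dixmier_trace_pos om (fun _ _ => 0) = 0.
Proof.
move=> hom; have L0 := @L1inf0 R.
apply: (@om_small _ _ hom _ 0); first exact: dixmier_fun_Linf.
move=> t t0; rewrite dixmier_funE // big1 => [|k _]; last exact: sing_val0.
by rewrite sing_val0 mulr0 addr0 mulr0 normr0 mul0r.
Qed.

Lemma dixmier_trace_osc om : ext_limit om ->
  dixmier_trace_pos om osc_op = 4 + om (osc 1 0).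
Proof.
move=> hom; have [_ LA] := osc_op_pos_L1inf.
have Lo := @Linf_osc R 1 0; have L4 := @Linf_cst R 4.
apply: (etrans _ (congr1 (+%R^~ (om (osc 1 0))) (om_cst hom 4))).
apply: (etrans _ (om_add hom L4 Lo)).
have [C hC] := @osc_step_integral_near R.
apply: (@om_eq_small _ _ hom _ _ C) => //; [exact: dixmier_fun_Linf|exact: LinfD|].
move=> t t0; have l0 : 0 < ln (1 + t) by rewrite ln_gt0 // ltrDl.
rewrite dixmier_funE //; under eq_bigr => k _ do rewrite sing_val_osc.
rewrite sing_val_osc -[4 + _](mulKf (lt0r_neq0 l0)) -mulrBr normrM mulrC.
rewrite [`|_^-1|]ger0_norm ?invr_ge0 ?(ltW l0) // ler_wpM2r ?invr_ge0 ?(ltW l0) //.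
exact: hC.
Qed.

(** The five numbers are values of positive forms, hence real, so the two components of the
    decomposition separate. *)
Lemma real_parts (a b c d f : R[i]) : complex.Im a = 0 -> complex.Im b = 0 ->
  complex.Im c = 0 -> complex.Im d = 0 -> complex.Im f = 0 ->
  a = b - c + 'i * (d - f) ->
  complex.Re a + complex.Re c = complex.Re b /\ complex.Re d = complex.Re f.
Proof.
case: a b c d f => [? ?] [? ?] [? ?] [? ?] [? ?] /= -> -> -> -> -> [h1 h2].
by split; lra.
Qed.

(** [t0] is the trace of the zero operator, which pads the identities to the four operators of
    [dixmier_additive]. *)
Lemma trace_combination (tA t0 t1 t2 t3 t4 w : R) : t0 = 0 -> tA = w ->
  tA + t2 = t1 + t0 -> t3 + t0 = t4 + t0 -> (t1 - t2)%:C + 'i * (t3 - t4)%:C = w%:C.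
Proof.
move=> -> -> e1 e2; have -> : t3 - t4 = 0 by lra.
have -> : t1 - t2 = w by lra.
by rewrite mulr0 addr0.
Qed.

(** Independence of the decomposition: comparing forms gives A + B2 = B1 + 0 and B3 + 0 = B4 + 0,
    and additivity transfers both identities to the traces. *)
Lemma ext_trace_value_osc om v : ext_limit om -> ext_trace_value om osc_op v ->
  v = (4 + om (osc 1 0))%:C.
Proof.
move=> hom [B1 [B2 [B3 [B4 [[p1 [p2 [p3 p4]]] hA ->]]]]].
have [b1 b2 b3 b4] := And4 p1.2.1 p2.2.1 p3.2.1 p4.2.1.
have bA := osc_op_bounded; have pA := osc_op_pos_L1inf; have p0 := pos_L1inf0.
have b0 := @is_bounded_op0 R; have Hip := @l2T_inner_product R.
have E w : liftT bA w = liftT b1 w - liftT b2 w + 'i *: (liftT b3 w - liftT b4 w).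
  by apply: val_inj; exact: (hA _ (l2valP w)).
have ipE w : ipT (liftT bA w) w = ipT (liftT b1 w) w - ipT (liftT b2 w) w +
    'i * (ipT (liftT b3 w) w - ipT (liftT b4 w) w).
  by rewrite E (ipDl Hip) (ipZl Hip) !(ipBl Hip).
have q0 w : qform (@ipT R) (liftT b0) w = 0.
  by rewrite /qform (_ : liftT b0 w = 0) ?ip0l //; exact: val_inj.
have im (B : op R) (pB : pos_L1inf B) (bB : is_bounded_op B) w : complex.Im (ipT (liftT bB w) w) = 0.
  exact: (pos_Im (liftT_positive bB pB.1) w).
have qE w : qform (@ipT R) (liftT bA) w + qform (@ipT R) (liftT b2) w =
    qform (@ipT R) (liftT b1) w /\
    qform (@ipT R) (liftT b3) w = qform (@ipT R) (liftT b4) w.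
  exact: real_parts (im _ pA _ _) (im _ p1 _ _) (im _ p2 _ _) (im _ p3 _ _) (im _ p4 _ _)
    (ipE w).
have e1 : dixmier_trace_pos om osc_op + dixmier_trace_pos om B2 =
    dixmier_trace_pos om B1 + dixmier_trace_pos om (fun _ _ => 0).
  apply: (dixmier_additive (h1 := bA) (h2 := b2) (h3 := b1) (h4 := b0) hom pA p2 p1 p0) => w.
  by rewrite q0 addr0 (qE w).1.
have e2 : dixmier_trace_pos om B3 + dixmier_trace_pos om (fun _ _ => 0) =
    dixmier_trace_pos om B4 + dixmier_trace_pos om (fun _ _ => 0).
  apply: (dixmier_additive (h1 := b3) (h2 := b0) (h3 := b4) (h4 := b0) hom p3 p0 p4 p0) => w.
  by rewrite (qE w).2.
exact: (trace_combination (dixmier_trace0 hom) (dixmier_trace_osc hom) e1 e2).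
Qed.

(** [measurable_for] only compares values that are attained, so refuting it requires an actual
    decomposition. *)
Lemma ext_trace_value_osc_exists om : ext_limit om ->
  ext_trace_value om osc_op (4 + om (osc 1 0))%:C.
Proof.
move=> hom; exists osc_op, (fun _ _ => 0), (fun _ _ => 0), (fun _ _ => 0).
have p0 := pos_L1inf0; split.
- by split; [exact: osc_op_pos_L1inf|].
- by move=> x _; apply/funext => k; rewrite !subr0 mulr0 addr0.
by rewrite dixmier_trace0 // dixmier_trace_osc // !subr0 mulr0 addr0.
Qed.

End Counterexample.

Theorem theorem7p9 (R : realType) :
  (forall A : op R, L1inf A -> dixmier_measurable A -> DM_measurable A) /\
  (exists A : op R, [/\ L1inf A, DM_measurable A & ~ dixmier_measurable A]).
Proof.
(* Traces in D_M are Dixmier traces, so the inclusion restricts a quantifier. *)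
split=> [A _ hA om1 om2 v1 v2 [h1 _] [h2 _]|]; first exact: hA.
exists (@osc_op R); split; first exact: (@osc_op_pos_L1inf R).2.
  move=> om1 om2 v1 v2 h1 h2 /(ext_trace_value_osc h1.1.1) -> /(ext_trace_value_osc h2.1.1) ->.
  by rewrite !DM_osc_eq0.
(* The two traces take values at least 4 + cos 1 and at most 4 - cos 1, and cos 1 is positive. *)
move=> hA; have [om1 [h1 b1]] := dixmier_omega_osc R 0.
have [om2 [h2 b2]] := dixmier_omega_osc R 1.
have := hA _ _ _ _ h1 h2 (ext_trace_value_osc_exists h1.1) (ext_trace_value_osc_exists h2.1).
move=> [] h; rewrite expr0 mul1r in b1; rewrite expr1 mulN1r in b2.
have := @cos1_gt0 R; lra.
Qed.
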